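(* Let $H$ be a semisimple Hopf algebra over an algebraically closed field $K$ of characteristic zero, and let $V$ be a nonzero finite-dimensional $H$-module. Then the order $\operatorname{ord}(V)$ of $V$ is a finite number. It is not larger than $\dim(H)$ and divides $\dim(H)\operatorname{mult}(V)$.
   Context: A semisimple Hopf algebra is finite-dimensional; let $\varepsilon$ denote its counit. Tensor powers $V^{\otimes m}$ carry the diagonal $H$-action, and $(V^{\otimes m})^H=\{w\in V^{\otimes m}: h.w=\varepsilon(h)w \text{ for all } h\in H\}$. The order $\operatorname{ord}(V)$ is the smallest natural number $m\ge1$ such that $(V^{\otimes m})^H\neq 0$ (and infinite if no such $m$ exists). If $m=\operatorname{ord}(V)$, the multiplicity of $V$ is $\operatorname{mult}(V):=\dim((V^{\otimes m})^H)$. Modules are left modules. *)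

(* Defs.v *)
From HB Require Import structures.
From mathcomp Require Import all_boot all_algebra all_field.
From mathcomp Require Import boolp.

Set Implicit Arguments.
Unset Strict Implicit.
Unset Printing Implicit Defensive.

Import GRing.Theory VectorInternalTheory.
Local Open Scope ring_scope.

Section TensorProduct.
Variable K : fieldType.
Implicit Types U W X Y : vectType K.

(* U (x) W is realized as the space of coefficient matrices with respect to   *)
(* the coordinates v2r of U and W; u (x) w is then a rank one matrix. The     *)
(* universal property is established by tliftE and tlift_unique below.        *)
Definition tens U W : vectType K := 'M[K]_(dim U, dim W).

Definition tpure U W (u : U) (w : W) : tens U W := (v2r u)^T *m v2r w.

Local Notation "u ⊗ w" := (tpure u w) (at level 40, left associativity).

Definition tlift U W X (f : U -> W -> X) (t : tens U W) : X :=
  \sum_i \sum_j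
    (t : 'M_(dim U, dim W)) i j *: f (r2v (delta_mx 0 i)) (r2v (delta_mx 0 j)).

Definition tmap U W U' W' (f : U -> U') (g : W -> W') : tens U W -> tens U' W' :=
  tlift (fun u w => f u ⊗ g w).

Definition tassoc U W X : tens (tens U W) X -> tens U (tens W X) :=
  tlift (fun t x => tlift (fun u w => u ⊗ (w ⊗ x)) t).

Fact tlift_is_linear U W X (f : U -> W -> X) : linear (tlift f).
Proof.
move=> a s t; rewrite /tlift scaler_sumr -big_split; apply: eq_bigr => i _.
rewrite scaler_sumr -big_split; apply: eq_bigr => j _.
by rewrite !mxE scalerDl scalerA.
Qed.
HB.instance Definition _ U W X (f : U -> W -> X) :=
  GRing.isLinear.Build K (tens U W) X _ (tlift f) (tlift_is_linear f).

Fact tmap_is_linear U W U' W' (f : U -> U') (g : W -> W') : linear (tmap f g).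
Proof. exact: tlift_is_linear. Qed.
HB.instance Definition _ U W U' W' (f : U -> U') (g : W -> W') :=
  GRing.isLinear.Build K (tens U W) (tens U' W') _ (tmap f g)
    (tmap_is_linear f g).

Lemma tpure_linearl U W (w : W) : linear (fun u : U => u ⊗ w).
Proof. by move=> a u v; rewrite /tpure !linearP /= mulmxDl -scalemxAl. Qed.

Lemma tpure_linearr U W (u : U) : linear (fun w : W => u ⊗ w).
Proof. by move=> a v w; rewrite /tpure linearP mulmxDr -scalemxAr. Qed.

Fact lin_sum U X I (r : seq I) (f : U -> X) (c : I -> K) (x : I -> U) :
  linear f -> f (\sum_(i <- r) c i *: x i) = \sum_(i <- r) c i *: f (x i).
Proof.
move=> fL; pose fM := GRing.isLinear.Build _ _ _ _ _ fL.
pose g : {linear U -> X} := HB.pack f fM.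
by rewrite -[f]/(g : U -> X) linear_sum; apply: eq_bigr => i _; rewrite linearZ.
Qed.

Fact vect_sum_delta U (u : U) :
  u = \sum_i v2r u 0 i *: r2v (delta_mx 0 i).
Proof.
by rewrite -{1}[u]v2rK {1}[v2r u]row_sum_delta linear_sum; apply: eq_bigr => i _;
   rewrite linearZ.
Qed.

Lemma tliftE U W X (f : U -> W -> X) u w :
    (forall w, linear (fun u => f u w)) -> (forall u, linear (f u)) ->
  tlift f (u ⊗ w) = f u w.
Proof.
move=> fl fr; rewrite [in RHS](vect_sum_delta u) (lin_sum _ _ _ (fl w)).
apply: eq_bigr => i _; rewrite [in RHS](vect_sum_delta w) (lin_sum _ _ _ (fr _)).
rewrite scaler_sumr; apply: eq_bigr => j _.
by rewrite scalerA !mxE big_ord1 mxE.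
Qed.

Lemma tens_sum U W (t : tens U W) :
  t = \sum_i \sum_j (t : 'M_(_, _)) i j *:
        (r2v (delta_mx 0 i) ⊗ r2v (delta_mx 0 j)).
Proof.
rewrite {1}[t]matrix_sum_delta; apply: eq_bigr => i _; apply: eq_bigr => j _.
by rewrite /tpure !r2vK trmx_delta mul_delta_mx.
Qed.

Lemma tens_ext U W X (f g : tens U W -> X) : linear f -> linear g ->
  (forall u w, f (u ⊗ w) = g (u ⊗ w)) -> f =1 g.
Proof.
move=> fL gL fg t.
pose f' : {linear tens U W -> X} := HB.pack f (GRing.isLinear.Build _ _ _ _ _ fL).
pose g' : {linear tens U W -> X} := HB.pack g (GRing.isLinear.Build _ _ _ _ _ gL).
rewrite -[f]/(f' : _ -> X) -[g]/(g' : _ -> X) [t]tens_sum !linear_sum.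
apply: eq_bigr => i _; rewrite !linear_sum; apply: eq_bigr => j _.
by rewrite !linearZ /= fg.
Qed.

Lemma tlift_unique U W X (f : U -> W -> X) (g : tens U W -> X) :
    (forall w, linear (fun u => f u w)) -> (forall u, linear (f u)) ->
    linear g -> (forall u w, g (u ⊗ w) = f u w) ->
  g =1 tlift f.
Proof.
move=> fl fr gL gf; apply: tens_ext => //; first exact: tlift_is_linear.
by move=> u w; rewrite gf tliftE.
Qed.

Lemma tlift_comp U W X Y (g : {linear X -> Y}) (f : U -> W -> X) t :
  g (tlift f t) = tlift (fun u w => g (f u w)) t.
Proof.
rewrite /tlift linear_sum; apply: eq_bigr => i _.
by rewrite linear_sum; apply: eq_bigr => j _; rewrite linearZ.
Qed.

Lemma tmapE U W U' W' (f : U -> U') (g : W -> W') u w :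
  linear f -> linear g -> tmap f g (u ⊗ w) = f u ⊗ g w.
Proof.
move=> fL gL; rewrite /tmap tliftE // => [v|v] a x y.
  by rewrite fL tpure_linearl.
by rewrite gL tpure_linearr.
Qed.

End TensorProduct.

Notation "u ⊗ w" := (tpure u w) (at level 40, left associativity) : ring_scope.

Definition tmul (K : fieldType) (A : falgType K) (s t : tens A A) : tens A A :=
  tlift (fun a b => tlift (fun c d => (a * c) ⊗ (b * d)) t) s.

Record hopfAlg (K : fieldType) := HopfAlg {
  hopf_falg :> falgType K;
  comul : hopf_falg -> tens hopf_falg hopf_falg;
  counit : hopf_falg -> K;
  antipode : hopf_falg -> hopf_falg;
  comul_linear : linear comul;
  counit_linear : linear_for *%R counit;
  antipode_linear : linear antipode;
  comulA : forall h, tassoc (tmap comul id (comul h)) = tmap id comul (comul h);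
  counitl : forall h, tlift (fun a b => counit a *: b) (comul h) = h;
  counitr : forall h, tlift (fun a b => counit b *: a) (comul h) = h;
  comul1 : comul 1 = 1 ⊗ 1;
  comulM : forall g h, comul (g * h) = tmul (comul g) (comul h);
  counit1 : counit 1 = 1;
  counitM : forall g h, counit (g * h) = counit g * counit h;
  antipodel : forall h,
    tlift (fun a b => antipode a * b) (comul h) = (counit h)%:A;
  antipoder : forall h,
    tlift (fun a b => a * antipode b) (comul h) = (counit h)%:A
}.

Record lmodule (K : fieldType) (A : falgType K) := LModule {
  lmodule_vect :> vectType K;
  act : A -> lmodule_vect -> lmodule_vect;
  act_linearl : forall v, linear (fun a => act a v);
  act_linearr : forall a, linear (act a);
  act1 : forall v, act 1 v = v;
  actM : forall a b v, act (a * b) v = act a (act b v)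
}.

Section Semisimple.
Variables (K : fieldType) (A : falgType K).

Definition submodule (V : lmodule A) (U : {vspace V}) : Prop :=
  forall a u, u \in U -> act a u \in U.

Definition semisimple_module (V : lmodule A) : Prop :=
  forall U : {vspace V}, submodule U ->
    exists U' : {vspace V},
      [/\ submodule U', (U + U' = fullv)%VS & (U :&: U' = 0)%VS].

Definition regular_module : lmodule A.
Proof.
exists A (fun a v => a * v) => [v b x y|a b x y|v|a b v].
- by rewrite mulrDl scalerAl.
- by rewrite mulrDr scalerAr.
- exact: mul1r.
- by rewrite mulrA.
Defined.

Definition semisimple : Prop := semisimple_module regular_module.

End Semisimple.

Section HopfModules.
Variables (K : fieldType) (H : hopfAlg K).
Implicit Types U V W : lmodule H.

Definition trivial_module : lmodule H.
Proof.
exists K^o (fun h (x : K^o) => counit h *: x) => [v b x y|a b x y|v|a b v].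
- by rewrite counit_linear scalerDl scalerA.
- by rewrite scalerDr !scalerA mulrC.
- by rewrite counit1 scale1r.
- by rewrite counitM scalerA.
Defined.

Definition diag_act U W (h : H) (t : tens U W) : tens U W :=
  tlift (fun a b => tmap (act (l := U) a) (act (l := W) b) t) (comul h).

Fact tmap_act_linearl U W (t : tens U W) b :
  linear (fun a => tmap (act (l := U) a) (act (l := W) b) t).
Proof.
move=> c x y; rewrite /tmap /tlift scaler_sumr -big_split; apply: eq_bigr => i _.
rewrite scaler_sumr -big_split; apply: eq_bigr => j _.
by rewrite act_linearl tpure_linearl scalerDr !scalerA mulrC.
Qed.

Fact tmap_act_linearr U W (t : tens U W) a :
  linear (fun b => tmap (act (l := U) a) (act (l := W) b) t).
Proof.
move=> c x y; rewrite /tmap /tlift scaler_sumr -big_split; apply: eq_bigr => i _.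
rewrite scaler_sumr -big_split; apply: eq_bigr => j _.
by rewrite act_linearl tpure_linearr scalerDr !scalerA mulrC.
Qed.

Fact diag_act_linearr U W h : linear (diag_act (U := U) (W := W) h).
Proof.
move=> c x y; rewrite /diag_act /tlift scaler_sumr -big_split.
apply: eq_bigr => i _; rewrite scaler_sumr -big_split; apply: eq_bigr => j _.
by rewrite linearP scalerDr !scalerA mulrC.
Qed.

Fact tlift_tmul U W (s s' : tens H H) (t : tens U W) :
  tlift (fun a b => tmap (act (l := U) a) (act (l := W) b) t) (tmul s s') =
  tlift (fun a b => tmap (act (l := U) a) (act (l := W) b)
    (tlift (fun a b => tmap (act (l := U) a) (act (l := W) b) t) s')) s.
Proof.
pose F (t : tens U W) (a b : H) := tmap (act (l := U) a) (act (l := W) b) t.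
have Fl t' b : linear (fun a => F t' a b) by exact: tmap_act_linearl.
have Fr t' a : linear (fun b => F t' a b) by exact: tmap_act_linearr.
have mulL (a b : H) : linear (fun s => tlift (fun c d : H => (a * c) ⊗ (b * d)) s).
  exact: tlift_is_linear.
have FM a b c d : F t (a * c) (b * d) = F (F t c d) a b.
  move: t; apply: tens_ext => [||u w]; rewrite /F.
  - exact: tmap_is_linear.
  - by move=> x y z; rewrite !linearP.
  by rewrite !tmapE ?actM //; exact: act_linearr.
have mL (a b : H) (s0 : tens H H) : tlift (F t) (tlift (fun c d => (a * c) ⊗ (b * d)) s0)
   = F (tlift (F t) s0) a b.
  move: s0; apply: tens_ext => [||c d].
  - by move=> x y z; rewrite !linearP.
  - by move=> x y z; rewrite /F !linearP.
  rewrite (tliftE _ _ (Fl t) (Fr t)) tliftE => [|w x y z|w x y z]; last 2 first.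
  - by rewrite mulrDr -scalerAr tpure_linearl.
  - by rewrite mulrDr -scalerAr tpure_linearr.
  by rewrite (tliftE _ _ (Fl t) (Fr t)).
rewrite -[LHS]/(tlift (F t) _) -[RHS]/(tlift (F (tlift (F t) s')) s).
rewrite /tmul tlift_comp; apply: eq_bigr => i _; apply: eq_bigr => j _.
by rewrite /= mL.
Qed.

Definition tensor_module U W : lmodule H.
Proof.
exists (tens U W) (diag_act (U := U) (W := W)) => [v c x y|h|v|g h v].
- by rewrite /diag_act comul_linear linearP.
- exact: diag_act_linearr.
- rewrite /diag_act comul1 tliftE; last 2 first.
  + by move=> b; exact: tmap_act_linearl.
  + by move=> a; exact: tmap_act_linearr.
  move: v; apply: tens_ext => [|//|u w]; first exact: tmap_is_linear.
  by rewrite tmapE ?act1 //; exact: act_linearr.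
- by rewrite /diag_act comulM tlift_tmul.
Defined.

(* V^(x)0 = K and V^(x)(m+1) = V^(x)m (x) V                                   *)
Definition tensor_power V (m : nat) : lmodule H :=
  iter m (fun U => tensor_module U V) trivial_module.

Definition invariants V : {vspace V} :=
  lker (linfun (fun w : V => linfun (fun h : H => act h w - counit h *: w))).

Lemma invariantsP V (w : V) :
  reflect (forall h : H, act h w = counit h *: w) (w \in invariants V).
Proof.
have inner (w' : V) : linear (fun h : H => act h w' - counit h *: w').
  move=> a x y; rewrite act_linearl counit_linear scalerDl -scalerA scalerBr.
  by rewrite opprD addrACA.
have innerE (w' : V) (h : H) : linfun (fun h : H => act h w' - counit h *: w') h =
    act h w' - counit h *: w'.
  pose g : {linear H -> V} := HB.pack (fun h : H => act h w' - counit h *: w')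
    (GRing.isLinear.Build _ _ _ _ _ (inner w')).
  exact: (lfunE g h).
have outer : linear (fun w : V => linfun (fun h : H => act h w - counit h *: w)).
  move=> a x y; apply/lfunP => h; rewrite !lfun_simp !innerE.
  rewrite act_linearr scalerDr !scalerA scalerBr scalerA mulrC.
  by rewrite opprD addrACA.
pose g : {linear V -> 'Hom(H, V)} := HB.pack
  (fun w : V => linfun (fun h : H => act h w - counit h *: w))
  (GRing.isLinear.Build _ _ _ _ _ outer).
have gE : linfun (fun w : V => linfun (fun h : H => act h w - counit h *: w)) w =
  linfun (fun h : H => act h w - counit h *: w) by exact: (lfunE g w).
rewrite memv_ker gE; apply: (iffP eqP) => [E h|E].
  by apply/eqP; rewrite -subr_eq0 -innerE E lfunE.
by apply/lfunP => h; rewrite innerE E subrr lfunE.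
Qed.

Definition has_invariants V (m : nat) : bool :=
  (0 < m)%N && (invariants (tensor_power V m) != 0%VS).

(* None stands for infinite order. *)
Definition ord V : option nat :=
  if pselect (exists m, has_invariants V m) is left exm
  then Some (ex_minn exm) else None.

Definition mult V : nat :=
  if ord V is Some m then \dim (invariants (tensor_power V m)) else 0%N.

End HopfModules.

(* Main.v *)
(* Let n = dim H, let L be the integral of H with counit 1, and let chi be the
   character of V.  The convolution operator h |-> chi(h1) h2 on H has k-th
   power sum (of its eigenvalues) equal to n chi^k(L) = n dim (V^k)^H, where
   V^k is the tensor power.  These power sums are integers, hence the
   elementary symmetric functions of the eigenvalues are integers; if the
   power sums of index < m vanish, Newton's identity m e_m = +-p_m shows that
   m divides p_m.  They cannot vanish up to index n, because dim V is an
   eigenvalue (with eigenvector 1).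

   The trace formula tr (h |-> f(h1) h2) = n f(L) rests on the theorem of
   Larson and Radford that S^2 = 1.  Radford's trace formula gives
   tr (h |-> f(S^2(h)1) S^2(h)2) = f(L) tr(S^2).  Since S^2 is conjugation by
   an element with a central power (the distinguished grouplike element has
   finite order), tr(S^2) is a sum of terms |a|^2 / N with a a sum of roots of
   unity, hence nonzero.  This makes the integral on H two-sided, which gives
   S^4 = 1; applying the formula to the regular character shows that tr(S^2)
   is a multiple of n, so that the involution S^2 is the identity. *)
Require Import Defs.
From HB Require Import structures.
From mathcomp Require Import all_boot all_order all_algebra all_field.
From mathcomp Require Import cyclic boolp.
From mathcomp Require Import zify ring.

Set Implicit Arguments.
Unset Strict Implicit.
Unset Printing Implicit Defensive.

Import Order.TTheory GRing.Theory Num.Theory VectorInternalTheory.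
Local Open Scope ring_scope.

(** * Eigenvalues and integral power sums *)

(** By Newton's identities, integral power sums only make n! times each elementary symmetric
    function an integer. The remaining common denominator D is removed by repeatedly squaring all
    eigenvalues: power sums stay integral, D becomes D^2 by Gauss's lemma, yet D always divides n!.
    S^2 is inner because the form [x |-> tr (y |-> x * S (S y))] has S^2 as Nakayama automorphism,
    while the regular trace form is symmetric and nondegenerate: if [w] represents the former
    through the latter, S^2 is conjugation by [w]. If [S w' = w], then [w' * w] is central, and
    [w' = g * w] for the distinguished grouplike g; since g has finite order, a power of [w] is
    central. Positivity of |a|^2 has no meaning in K, which need not embed into the complex numbers.
    After clearing denominators, the vanishing of tr(S^2) would be an integral polynomial relation
    satisfied by a root of unity, and a resultant carries it over to [algC]. *)

Section Spectrum.
Variable K : closedFieldType.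

Lemma closed_eigenvector n (A : 'M[K]_n.+1) :
  exists a, exists2 v : 'rV[K]_n.+1, v != 0 & v *m A = a *: v.
Proof.
have /closed_rootP[a] : size (char_poly A) != 1 by rewrite size_char_poly.
by rewrite -eigenvalue_root_char => /eigenvalueP[v vA v0]; exists a; exists v.
Qed.

Lemma block_triangular_exp n (a : K) (b : 'cV[K]_n) (A : 'M[K]_n) k :
  exists b' : 'cV[K]_n,
    iter k (mulmx (block_mx a%:M 0 b A)) 1%:M =
      block_mx (a ^+ k)%:M 0 b' (iter k (mulmx A) 1%:M).
Proof.
elim: k => [|k [b' IHk]] /=; first by exists 0; rewrite -scalar_mx_block.
exists (b *m (a ^+ k)%:M + A *m b'); rewrite IHk mulmx_block.
by rewrite !mul0mx !mulmx0 !addr0 add0r -scalar_mxM exprS.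
Qed.

Lemma iter_mulmx_conj n (P A : 'M[K]_n) k : P \in unitmx ->
  iter k (mulmx (P *m A *m invmx P)) 1%:M =
    P *m iter k (mulmx A) 1%:M *m invmx P.
Proof.
move=> uP; elim: k => [|k IHk] /=; first by rewrite mulmx1 mulmxV.
by rewrite IHk !mulmxA mulmxKV.
Qed.

Lemma char_poly_conj n (A P : 'M[K]_n) :
  P \in unitmx -> char_poly (P *m A *m invmx P) = char_poly A.
Proof.
move=> uP; have uP' : map_mx polyC P \in unitmx by rewrite map_unitmx.
rewrite /char_poly (_ : char_poly_mx _ =
    map_mx polyC P *m char_poly_mx A *m invmx (map_mx polyC P)).
  by rewrite !det_mulmx mulrC mulrA -det_mulmx mulVmx // det1 mul1r.
rewrite /char_poly_mx mulmxBr mulmxBl scalar_mxC mulmxK //.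
by rewrite !map_mxM map_invmx.
Qed.

Lemma char_poly_lblock m n (A : 'M[K]_m) (B : 'M[K]_(n, m)) (C : 'M[K]_n) :
  char_poly (block_mx A 0 B C) = char_poly A * char_poly C.
Proof.
rewrite /char_poly /char_poly_mx map_block_mx (scalar_mx_block m n).
by rewrite opp_block_mx add_block_mx map_mx0 oppr0 addr0 det_lblock.
Qed.

Lemma spectrum n (A : 'M[K]_n) : exists s : seq K,
  [/\ size s = n, char_poly A = \prod_(x <- s) ('X - x%:P)
    & forall k, \tr (iter k (mulmx A) 1%:M) = \sum_(x <- s) x ^+ k].
Proof.
elim: n A => [|n IHn] A.
  exists [::]; split=> [//||k]; last by rewrite big_nil /mxtrace big_ord0.
  by rewrite big_nil /char_poly det_mx00.
have [a [v v0 vA]] := closed_eigenvector A.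
(* In the rank decomposition of the eigenvector [v], the first row of the invertible factor
   [row_ebase v] is proportional to [v]; conjugating by it splits off the eigenvalue. *)
have [P uP rP] : exists2 P : 'M[K]_(1 + n), P \in unitmx & (usubmx P *m A =
  a *: usubmx P).
  exists (row_ebase v); first exact: row_ebase_unit.
  set R : 'M[K]_(1 + n) := row_ebase v.
  have E1 : v = (col_ebase v 0 0) *: usubmx R.
    rewrite -[LHS]mulmx_ebase rank_rV v0 [col_ebase v]mx11_scalar -mulmxA.
    rewrite mul_scalar_mx !mxE; congr (_ *: _); rewrite -[row_ebase v]/R.
    rewrite -[R in LHS]vsubmxK (_ : pid_mx _ = row_mx (1%:M : 'M_1) 0).
      transitivity ((1%:M : 'M[K]_1) *m usubmx R + (0 : 'M_(1, n)) *m dsubmx R).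
        exact (@mul_row_col K 1 1 n _ 1%:M 0 (usubmx R) (dsubmx R)).
      by rewrite mul1mx mul0mx addr0.
    apply/matrixP => i j; rewrite !mxE (ord1 i); case: splitP => k kE.
      by rewrite (ord1 k) !mxE kE (ord1 k).
    by rewrite !mxE kE.
  have c0 : col_ebase v 0 0 != 0 by apply: contraNneq v0 => c0;
    rewrite E1 c0 scale0r.
  move: vA; rewrite [in X in X -> _]E1 -scalemxAl [in RHS]scalerA mulrC
    -scalerA.
  by move/(scalerI c0).
pose B : 'M[K]_(1 + n) := P *m A *m invmx P.
have uB : usubmx B = a *: usubmx (1%:M : 'M_(1 + n)).
  by rewrite /B -!mul_usub_mx rP -scalemxAl mul_usub_mx mulmxV.
have EB : B = block_mx a%:M 0 (dlsubmx B) (drsubmx B).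
  rewrite -[LHS]submxK; congr (block_mx _ _ _ _).
    by rewrite /ulsubmx uB linearZ /= (scalar_mx_block 1 n) block_mxEv col_mxKu
      row_mxKl scalemx1.
  by rewrite /ursubmx uB linearZ /= (scalar_mx_block 1 n) block_mxEv col_mxKu
    row_mxKr scaler0.
have [s [ss sc st]] := IHn (drsubmx B); exists (a :: s); split=> [|| k].
- by rewrite /= ss.
- rewrite -(char_poly_conj A uP) -/B EB big_cons -sc.
  have -> := char_poly_lblock (a%:M : 'M_1) (dlsubmx B) (drsubmx B).
  by rewrite /char_poly det_mx11 !mxE !eqxx.
rewrite big_cons -st; have := iter_mulmx_conj A k uP; rewrite -/B EB.
have [b' ->] := block_triangular_exp a (dlsubmx B) (drsubmx B) k.
move/(congr1 mxtrace); rewrite mxtrace_mulC mulmxA mulVmx // mul1mx => <-.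
have -> := mxtrace_block ((a ^+ k)%:M : 'M_1) 0 b' (iter k (mulmx (drsubmx B))
  1%:M).
by rewrite mxtrace_scalar mulr1n block_mxKdr.
Qed.
End Spectrum.

(** * Newton's identities and integrality of elementary symmetric functions *)

Lemma fact_dvd m n : (m <= n)%N -> (m`! %| n`!)%N.
Proof. by move=> mn; rewrite -(bin_fact mn) dvdn_mull // dvdn_mulr. Qed.

Section PowerSums.
Variables (K : fieldType) (K0 : [pchar K] =i pred0).
Implicit Type s : seq K.

Lemma natf_eq0 n : (n%:R == 0 :> K) = (n == 0)%N.
Proof. by have /pcharf0P -> := K0. Qed.

Lemma intf_inj : injective (intr : int -> K).
Proof.
move=> x y /eqP; rewrite -subr_eq0 -intrB => xy0; apply/eqP; rewrite -subr_eq0.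
by case: (x - y) xy0 => k; rewrite ?NegzE ?mulrNz ?oppr_eq0 [_ == 0]natf_eq0.
Qed.

Lemma intf_eq0 (z : int) : (z%:~R == 0 :> K) = (z == 0).
Proof. by rewrite -(inj_eq intf_inj). Qed.

(** The reversed characteristic polynomial: its coefficients are, up to sign, the elementary
    symmetric functions of [s]. *)
Definition recip s : {poly K} := \prod_(x <- s) (1 - x *: 'X).

(** The logarithmic derivative of [recip s] is minus the generating function of the power sums;
    truncating that series turns the identity into a congruence of polynomials modulo ['X^N]. *)
Lemma newton s N : exists R : {poly K},
  (recip s)^`() + recip s * \sum_(k < N) (\sum_(x <- s) x ^+ k.+1) *: 'X^k
    = 'X^N * R.
Proof.
elim: s => [|a s [R IHs]].
  exists 0; rewrite /recip big_nil derivC mulr0 add0r mul1r big1 // => k _.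
  by rewrite big_nil scale0r.
pose A : {poly K} := \sum_(k < N) a ^+ k.+1 *: 'X^k.
have EA : (1 - a *: 'X) * A = a%:P - a ^+ N.+1 *: 'X^N.
  rewrite /A; elim: N {A R IHs} => [|N IHN].
    by rewrite big_ord0 mulr0 expr1 expr0 alg_polyC subrr.
  rewrite big_ord_recr /= mulrDr IHN mulrBl mul1r -scalerAl -scalerAr -exprS.
  by rewrite scalerA -exprS addrA subrK.
exists ((1 - a *: 'X) * R - a ^+ N.+1 *: recip s).
rewrite /recip big_cons -/(recip s) derivM.
have -> : \sum_(k < N) (\sum_(x <- a :: s) x ^+ k.+1) *: 'X^k =
    A + \sum_(k < N) (\sum_(x <- s) x ^+ k.+1) *: 'X^k.
  by rewrite -big_split; apply: eq_bigr => k _; rewrite big_cons scalerDl.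
set P := (X in A + X); rewrite derivB derivC derivZ derivX sub0r.
have IHs' : (recip s)^`() = 'X^N * R - recip s * P by rewrite -IHs addrK.
rewrite IHs'; move: EA; rewrite -!mul_polyC polyC_exp => EA.
transitivity ((1 - a%:P * 'X) * ('X^N * R) + recip s * (- a%:P + (1 - a%:P *
  'X) * A)).
  by ring.
by rewrite EA; ring.
Qed.

Lemma size_recip s : (size (recip s) <= (size s).+1)%N.
Proof.
elim: s => [|a s IHs]; first by rewrite /recip big_nil size_poly1.
rewrite /recip big_cons -/(recip s) (leq_trans (size_polyMleq _ _)) //.
have : (size (1 - a *: 'X)%R <= 2)%N.
  rewrite (leq_trans (size_polyD _ _)) // geq_max size_poly1 size_polyN.
  by rewrite (leq_trans (size_scale_leq _ _)) // size_polyX.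
by move=> /leq_add/(_ IHs); case: (_ + _)%N.
Qed.

Lemma recip0 s : (recip s)`_0 = 1.
Proof.
rewrite -horner_coef0 /recip horner_prod big1 // => x _.
by rewrite hornerD hornerN hornerZ hornerX hornerC mulr0 subr0.
Qed.

Definition int_val (x : K) := exists z : int, x = z%:~R.

Lemma int_valM x y : int_val x -> int_val y -> int_val (x * y).
Proof. by move=> [a ->] [b ->]; exists (a * b); rewrite rmorphM. Qed.

Lemma int_val_sum I (r : seq I) (P : pred I) F :
  (forall i, P i -> int_val (F i)) -> int_val (\sum_(i <- r | P i) F i).
Proof.
move=> FZ; elim/big_rec: _ => [|i x /FZ[a ->] [b ->]]; first by exists 0.
by exists (a + b); rewrite rmorphD.
Qed.

Definition int_power_sums s :=
  forall k, (0 < k)%N -> int_val (\sum_(x <- s) x ^+ k).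

Lemma newton_coef s k : (recip s)`_k.+1 *+ k.+1 =
  - \sum_(i < k.+1) (recip s)`_i * \sum_(x <- s) x ^+ (k - i).+1.
Proof.
have [R /(congr1 (fun p : {poly K} => p`_k))] := newton s k.+1.
rewrite coefXnM ltnSn coefD coef_deriv coefM => /eqP;
  rewrite addr_eq0 => /eqP ->.
congr (- _); apply: eq_bigr => i _; congr (_ * _).
have ki : (k - i < k.+1)%N by rewrite ltnS leq_subr.
rewrite coef_sum (bigD1 (Ordinal ki)) //= coefZ coefXn eqxx mulr1.
rewrite [X in _ + X]big1 ?addr0 // => j /eqP jk.
by rewrite coefZ coefXn; case: eqP => [E|]; [case: jk;
  apply/val_inj|rewrite mulr0].
Qed.

(** Each use of Newton's identity divides by the current index, so the denominators accumulate to a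
    factorial. *)
Lemma recip_fact_int s : int_power_sums s ->
  forall k, int_val ((recip s)`_k *+ k`!).
Proof.
move=> sZ; elim/ltn_ind => -[|k] IHk; first by exists 1; rewrite recip0.
rewrite factS mulrnA newton_coef mulNrn -sumrMnl -mulN1r.
apply: int_valM; first by exists (-1); rewrite rmorphN.
apply: int_val_sum => i _; have ik := ltn_ord i; rewrite -mulrnAl.
apply: int_valM; last exact: sZ.
have -> : k`! = (i`! * (k`! %/ i`!))%N
  by rewrite mulnC divnK // fact_dvd // -ltnS.
rewrite mulrnA -mulr_natr; apply: int_valM; first exact: IHk.
by exists (Posz (k`! %/ i`!)).
Qed.

Lemma recip_int s : int_power_sums s ->
  exists F : {poly int}, map_poly intr F = (recip s) *+ (size s)`!.
Proof.
move=> sZ; have : forall i : 'I_(size s).+1,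
    exists z : int, (recip s)`_i *+ (size s)`! = z%:~R.
  move=> i; rewrite (_ : (size s)`! = i`! * ((size s)`! %/ i`!))%N.
    rewrite mulrnA -mulr_natr; apply: int_valM; first exact: recip_fact_int.
    by exists (Posz ((size s)`! %/ i`!)).
  by rewrite mulnC divnK // fact_dvd // -ltnS.
move=> /fin_all_exists[f fE]; exists (\poly_(i < (size s).+1) f (inord i)).
apply/polyP => i; rewrite coef_map coef_poly coefMn; case: ltnP => si.
  by rewrite /= -fE inordK.
by rewrite /= nth_default ?mul0rn // (leq_trans (size_recip s)).
Qed.

(* Up to sign, the integer [G`_0] is the least common denominator of the
  coefficients. *)
Lemma recip_primitive s : int_power_sums s -> exists G : {poly int},
  [/\ zcontents G = 1, G`_0 != 0, map_poly intr G = (G`_0)%:~R *: recip s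
    & (`|(G`_0)%R| %| (size s)`!)%N].
Proof.
move=> sZ; have [F FE] := recip_int sZ.
have F0 : F`_0 = Posz (size s)`!.
  by apply: intf_inj; rewrite -coef_map FE coefMn recip0.
have nz0 : Posz (size s)`! != 0 by rewrite -lt0n fact_gt0.
have FN0 : F != 0 by apply: contraNneq nz0 => F00; rewrite -F0 F00 coef0.
exists (zprimitive F); have FP := zpolyEprim F.
have cF : (size s)`!%:Z = zcontents F * (zprimitive F)`_0.
  by rewrite -F0 [in LHS]FP coefZ.
have g0 : (zprimitive F)`_0 != 0.
  by apply: contraNneq nz0 => g0; rewrite cF g0 mulr0.
have c0 : (zcontents F)%:~R != 0 :> K.
  by rewrite intf_eq0 zcontents_eq0.
split=> //; first by rewrite zcontents_primitive FN0.
  apply: (scalerI c0); rewrite scalerA -rmorphM -cF -map_polyZ -FP FE.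
  by rewrite scaler_nat.
by have /(congr1 absz) := cF; rewrite abszM /= => ->; rewrite dvdn_mull.
Qed.

Lemma map_poly_intf_inj : injective (map_poly (intr : int -> K)).
Proof.
move=> p q /polyP pq; apply/polyP => i; apply: intf_inj.
by rewrite -!coef_map pq.
Qed.

Lemma zcontents_prim (p : {poly int}) :
  (forall d : int, p \is a polyOver (dvdz d) -> (d %| 1)%Z) ->
    `|zcontents p|%N = 1%N.
Proof.
by move=> /(_ _ (etrans (esym (dvdz_contents _ _)) (dvdzz _)));
  rewrite dvdz1 => /eqP.
Qed.

Lemma coef_comp_polyNX (R : nzRingType) (p : {poly R}) i :
  (p \Po - 'X)`_i = (-1) ^+ i * p`_i.
Proof.
elim/poly_ind: p i => [|p c IHp] i; first by rewrite comp_poly0 !coef0 mulr0.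
rewrite comp_poly_MXaddC mulrN !coefD coefN !coefMX !coefC.
case: i => [|i] /=; first by rewrite oppr0 mul1r.
by rewrite !addr0 IHp exprS mulN1r mulNr.
Qed.

(** Graeffe's root squaring, from [1 - x^2 X^2 = (1 - x X) (1 + x X)]. *)
Lemma graeffe s : recip [seq x ^+ 2 | x <- s] \Po 'X^2 =
  recip s * (recip s \Po - 'X).
Proof.
rewrite /recip big_map !rmorph_prod /= -big_split; apply: eq_bigr => x _ /=.
rewrite !rmorphB !rmorph1 /= !comp_polyZ !comp_polyX exprS expr1 -scalerA.
by rewrite -!mul_polyC; ring.
Qed.

Lemma int_power_sums_sqr s : int_power_sums s ->
  int_power_sums [seq x ^+ 2 | x <- s].
Proof.
move=> sZ k k0; rewrite big_map; under eq_bigr do rewrite -exprM.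
by apply: sZ; rewrite muln_gt0.
Qed.

(** By Gauss's lemma [G(X) G(-X)] is primitive, and so is [H(X^2)]. They are proportional by root
    squaring, so comparing contents gives the constant coefficients up to sign. *)
Lemma recip_primitive_sqr s (G H : {poly int}) :
  zcontents G = 1 -> zcontents H = 1 ->
  G`_0 != 0 -> map_poly intr G = (G`_0)%:~R *: recip s ->
  map_poly intr H = (H`_0)%:~R *: recip [seq x ^+ 2 | x <- s] ->
  `|(H`_0)%R|%N = (`|(G`_0)%R| ^ 2)%N.
Proof.
move=> cG cH G0 GE HE.
have E : H`_0 *: (G * (G \Po - 'X)) = G`_0 ^+ 2 *: (H \Po 'X^2).
  apply: map_poly_intf_inj.
  rewrite !map_polyZ rmorphM /= !map_comp_poly rmorphN /= !map_polyX map_polyXn.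
  rewrite GE HE !comp_polyZ graeffe !scalerA -scalerAl -!scalerAr !scalerA.
  by congr (_ *: _); rewrite rmorphXn /=; ring.
have c1 : `|zcontents (G \Po - 'X)|%N = 1%N.
  apply: zcontents_prim => d /polyOverP dG.
  rewrite -[X in (_ %| X)%Z]cG dvdz_contents.
  apply/polyOverP => i; have := dG i.
  by rewrite coef_comp_polyNX dvdzE abszMsign.
have c2 : `|zcontents (H \Po 'X^2)|%N = 1%N.
  apply: zcontents_prim => d /polyOverP dH.
  rewrite -[X in (_ %| X)%Z]cH dvdz_contents.
  apply/polyOverP => i; have := dH (i * 2)%N.
  by rewrite coef_comp_poly_Xn // dvdn_mull // mulnK.
move/(congr1 (fun p => `|zcontents p|%N)): E.
rewrite !zcontentsZ zcontentsM cG mul1r.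
move: (zcontents (G \Po _)) (zcontents (H \Po _)) c1 c2 => a b c1 c2.
by rewrite !abszM c1 c2 !muln1.
Qed.

Lemma recip_int_coef s : int_power_sums s -> forall k, int_val (recip s)`_k.
Proof.
move=> sZ; have [G [cG G0 GE Gd]] := recip_primitive sZ.
suff G1 : `|(G`_0)%R|%N = 1%N.
  move=> k; have /(congr1 (fun p : {poly K} => p`_k)) := GE.
  rewrite coefZ coef_map /= => Ek; exists (G`_0 * G`_k).
  have gg : G`_0 * G`_0 = 1 by case: (G`_0) G1 => [[|[|]]|[|]].
  by rewrite intrM Ek mulrA -intrM gg mul1r.
apply/eqP; rewrite eqn_leq absz_gt0 G0 andbT leqNgt; apply/negP => G2.
(* Squaring [j] times turns a denominator of at least 2 into one of at least 2^(2^j), for a list of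
   the same length. *)
have bound j : exists t, exists H : {poly int}, [/\ size t =
  size s, int_power_sums t,
    zcontents H = 1, H`_0 != 0 & [/\ map_poly intr H = (H`_0)%:~R *: recip t
    & (2 ^ 2 ^ j <= `|(H`_0)%R|)%N]].
  elim: j => [|j [t [H [st tZ cH H0 [HE le_H]]]]]; first by exists s, G.
  have [H' [cH' H'0 H'E _]] := recip_primitive (int_power_sums_sqr tZ).
  exists [seq x ^+ 2 | x <- t], H'; split=> //; first by rewrite size_map.
    exact: int_power_sums_sqr.
  split=> //; rewrite (recip_primitive_sqr cH cH' H0 HE H'E).
  by rewrite expnS mulnC expnM leq_exp2r.
(* The number n! of squarings already suffices, because n! < 2^(2^n!), while every denominator
   divides n!. The primitive multiples [H] and [H'] of the same [recip t] have the same constant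
   coefficient up to sign. *)
have [t [H [st tZ cH H0 [HE le_H]]]] := bound (size s)`!.
have [H' [cH' H'0 H'E H'd]] := recip_primitive tZ.
have EH : H'`_0 *: H = H`_0 *: H'.
  apply: map_poly_intf_inj; rewrite !map_polyZ /= HE H'E !scalerA.
  by rewrite mulrC.
move/(congr1 (fun p => `|zcontents p|%N)): EH.
rewrite !zcontentsZ cH cH' !mulr1 => EH.
have := dvdn_leq (fact_gt0 _) H'd; rewrite EH st => le_H'.
have := leq_trans le_H le_H'; rewrite leqNgt => /negP; apply.
by apply: ltn_trans (ltn_expl _ _) (ltn_expl _ _).
Qed.

Lemma power_sums_divisibility s (N : nat -> nat) :
    (forall k, (0 < k)%N -> \sum_(x <- s) x ^+ k = (N k)%:R) ->
  forall m, (0 < m)%N -> (forall k, (0 < k < m)%N -> N k = 0%N) -> (m %| N m)%N.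
Proof.
move=> sN [//|m] _ Nm.
have sZ : int_power_sums s by move=> k /sN ->; exists (Posz (N k)).
have := newton_coef s m; rewrite big_ord_recl /= recip0 mul1r subn0 sN //.
rewrite big1 ?addr0 => [E|i _]; last first.
  rewrite sN // Nm ?mulr0 //= /bump /=; have := ltn_ord i; lia.
have [z zE] := recip_int_coef sZ m.+1.
have /intf_inj : (z * m.+1%:Z)%:~R = (- (N m.+1)%:Z)%:~R :> K.
  by rewrite rmorphM rmorphN /= -zE -E -mulr_natr.
move/(congr1 absz); rewrite abszN abszM /= => <-; exact: dvdn_mull.
Qed.

(** If the power sums up to the length of [s] vanish, Newton's identities give [recip s = 1],
    although a nonzero [x] in [s] makes [x^-1] a root. *)
Lemma power_sums_nonzero s (N : nat -> nat) :
    (forall k, (0 < k)%N -> \sum_(x <- s) x ^+ k = (N k)%:R) ->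
  has (fun x => x != 0) s -> exists2 k, (0 < k <= size s)%N & N k != 0%N.
Proof.
move=> sN /hasP[x xs x0].
have [/existsP[k Nk]|] := boolP [exists k : 'I_(size s), N k.+1 != 0%N].
  by exists k.+1 => //=; rewrite ltn_ord.
rewrite negb_exists => /forallP N0.
have rk k : (k < size s)%N -> (recip s)`_k.+1 = 0.
  move=> ks; apply/eqP; have := newton_coef s k.
  rewrite big1 ?oppr0 => [/eqP|i _].
    by rewrite -mulr_natr mulf_eq0 [_%:R == 0]natf_eq0 orbF.
  have ki : (k - i < size s)%N by rewrite (leq_ltn_trans (leq_subr _ _)).
  by rewrite sN //; have := N0 (Ordinal ki); rewrite negbK /= => /eqP ->;
    rewrite mulr0.
have : recip s = 1.
  apply/polyP => -[|k]; first by rewrite recip0 coef1.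
  rewrite coef1; case: (ltnP k (size s)) => [/rk //|sk].
  by rewrite nth_default // (leq_trans (size_recip s)).
move/(congr1 (horner^~ x^-1)); rewrite hornerC /recip horner_prod => /eqP.
rewrite (big_rem x) //= hornerD hornerN hornerZ hornerX hornerC mulfV // subrr
  mul0r.
by rewrite eq_sym oner_eq0.
Qed.

End PowerSums.

(** * Traces of linear endomorphisms *)

Definition vbas (K : fieldType) (V : vectType K) (i : 'I_(dim V)) : V :=
  r2v (delta_mx 0 i).
Definition vcoef (K : fieldType) (V : vectType K) (i : 'I_(dim V)) (x : V) : K
  :=
  v2r x 0 i.
(* Defined for arbitrary functions, but a trace only when [f] is linear. *)
Definition ltrace (K : fieldType) (V : vectType K) (f : V -> V) : K :=
  \sum_i vcoef i (f (vbas i)).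
Arguments vbas {K V}.

(** The operations of Hopf algebras and modules are bare functions with a proof of linearity, hence
    these variants of the lemmas on linear maps. *)
Lemma linear_fun_sum (K : fieldType) (U X : lmodType K) I (r : seq I) (P :
  pred I) (f : U -> X)
  (x : I -> U) : linear f -> f (\sum_(i <- r | P i) x i) =
    \sum_(i <- r | P i) f (x i).
Proof.
move=> fL; pose fM := GRing.isLinear.Build _ _ _ _ _ fL.
pose g : {linear U -> X} := HB.pack f fM.
by rewrite -[f]/(g : U -> X) linear_sum.
Qed.

Lemma linear_fun0 (K : fieldType) (U X : lmodType K) (f : U -> X) :
  linear f -> f 0 = 0.
Proof. by move=> fL; have := fL (-1) 0 0;
  rewrite scaler0 addr0 scaleN1r addNr. Qed.

Lemma linear_funD (K : fieldType) (U X : lmodType K) (f : U -> X) x y :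
  linear f -> f (x + y) = f x + f y.
Proof. by move=> fL; have := fL 1 x y; rewrite !scale1r. Qed.

Lemma linear_funZ (K : fieldType) (U X : lmodType K) (f : U -> X) a x :
  linear f -> f (a *: x) = a *: f x.
Proof. by move=> fL; have := fL a x 0;
  rewrite !addr0 (linear_fun0 fL) addr0. Qed.

Lemma scalar_fun_sum (K : fieldType) (U : lmodType K) I (r : seq I) (P :
  pred I) (f : U -> K)
  (x : I -> U) : scalar f -> f (\sum_(i <- r | P i) x i) =
    \sum_(i <- r | P i) f (x i).
Proof. exact: (@linear_fun_sum K U K^o). Qed.

Lemma scalar_funZ (K : fieldType) (U : lmodType K) (f : U -> K) a x :
  scalar f -> f (a *: x) = a * f x.
Proof. exact: (@linear_funZ K U K^o). Qed.

Section Trace.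
Variables (K : fieldType) (V : vectType K).
Implicit Types f g : V -> V.

Lemma vcoef_linear i : scalar (@vcoef K V i).
Proof. by move=> a x y; rewrite /vcoef linearP !mxE. Qed.

Lemma vbas_sum (x : V) : x = \sum_i vcoef i x *: vbas i.
Proof. exact: vect_sum_delta. Qed.

Lemma vcoef_vbas i j : vcoef i (vbas j : V) = (j == i)%:R.
Proof. by rewrite /vcoef /vbas r2vK mxE eqxx eq_sym. Qed.

Lemma vbas_lin (X : vectType K) (f : V -> X) x : linear f ->
  f x = \sum_i vcoef i x *: f (vbas i).
Proof. by move=> fL; rewrite {1}[x]vbas_sum (lin_sum _ _ _ fL). Qed.

Lemma vbas_scalar (f : V -> K) x :
  scalar f -> f x = \sum_i vcoef i x * f (vbas i).
Proof. exact: (@vbas_lin K^o f x). Qed.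

Lemma vbas_ext (X : vectType K) (f g : V -> X) : linear f -> linear g ->
  (forall i, f (vbas i) = g (vbas i)) -> f =1 g.
Proof.
by move=> fL gL fg x; rewrite (vbas_lin x fL) (vbas_lin x gL);
  apply: eq_bigr => i _; rewrite fg.
Qed.

Lemma vbas_ext_scalar (f g : V -> K) : scalar f -> scalar g ->
  (forall i, f (vbas i) = g (vbas i)) -> f =1 g.
Proof. exact: (@vbas_ext K^o). Qed.

Lemma vcoef_ext (x y : V) : (forall i, vcoef i x = vcoef i y) -> x = y.
Proof. by move=> xy; rewrite [x]vbas_sum [y]vbas_sum; apply: eq_bigr => i _;
  rewrite xy. Qed.

Lemma eq_ltrace f g : f =1 g -> ltrace f = ltrace g.
Proof. by move=> fg; apply: eq_bigr => i _; rewrite fg. Qed.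

(** Trace of a sum of rank one maps. The [v k] need not form a basis, so this takes the place of
    changes of basis. *)
Lemma ltrace_dual (I : finType) (phi : I -> V -> K) (v : I -> V) f :
    (forall k, scalar (phi k)) -> (forall x, f x = \sum_k phi k x *: v k) ->
  ltrace f = \sum_k phi k (v k).
Proof.
move=> phiL fE; rewrite /ltrace; under eq_bigr => i _.
  rewrite fE (lin_sum (X := K^o) _ _ _ (@vcoef_linear i)); over.
rewrite exchange_big; apply: eq_bigr => k _;
  rewrite (vbas_scalar (v k) (phiL k)).
by apply: eq_bigr => i _; rewrite mulrC.
Qed.

Lemma ltrace_proj (U : {vspace V}) f : linear f ->
  (forall x, f x \in U) -> {in U, forall x, f x = x} -> ltrace f = (\dim U)%:R.
Proof.
move=> fL fU fid; pose X := vbasis U.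
rewrite (@ltrace_dual _ (fun k x => coord X k (f x)) (fun k => X`_k)).
- rewrite (eq_bigr (fun=> 1)) => [|k _]; first by rewrite sumr_const card_ord.
  have XkU : X`_k \in U by rewrite vbasis_mem // mem_nth // size_tuple.
  by rewrite fid // coord_free ?eqxx //; apply: basis_free (vbasisP U).
- by move=> k a x y; rewrite fL linearP.
by move=> x; rewrite [LHS](coord_vbasis (fU x)).
Qed.

Lemma ltrace_comp f g : linear f -> linear g ->
  ltrace (f \o g) = ltrace (g \o f).
Proof.
move=> fL gL; rewrite (@ltrace_dual _ (fun k x => vcoef k (g x)) (fun k => f
  (vbas k))) //.
  by move=> k a x y; rewrite gL vcoef_linear.
by move=> x /=; rewrite (vbas_lin (g x) fL).
Qed.

Lemma ltraceZ a f : ltrace (fun x => a *: f x) = a * ltrace f.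
Proof.
rewrite /ltrace mulr_sumr; apply: eq_bigr => i _.
exact: (linear_funZ _ _ (@vcoef_linear i : linear (vcoef i : V -> K^o))).
Qed.

Lemma ltraceD f g : ltrace (fun x => f x + g x) = ltrace f + ltrace g.
Proof.
rewrite /ltrace -big_split; apply: eq_bigr => i _.
exact: (linear_funD _ _ (@vcoef_linear i : linear (vcoef i : V -> K^o))).
Qed.

Lemma ltrace_sum (I : finType) (P : pred I) (f : I -> V -> V) :
  ltrace (fun x => \sum_(i | P i) f i x) = \sum_(i | P i) ltrace (f i).
Proof.
rewrite /ltrace exchange_big; apply: eq_bigr => i _.
exact: (linear_fun_sum _ _ _ (@vcoef_linear i : linear (vcoef i : V -> K^o))).
Qed.

Lemma ltrace_id : ltrace (@id V) = (\dim {:V})%:R.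
Proof. by rewrite (@ltrace_proj fullv) // => x; rewrite memvf. Qed.

End Trace.

Lemma ltrace_spectrum (K : closedFieldType) (V : vectType K) (f : V -> V) :
  linear f ->
  exists s : seq K, [/\ size s = \dim {:V}, forall k, ltrace (iter k f) =
    \sum_(x <- s) x ^+ k,
   forall a, a \in s -> exists2 x, x != 0 & f x = a *: x
  & forall a x, x != 0 -> f x = a *: x -> a \in s].
Proof.
move=> fL; pose M := \matrix_(i, j) vcoef j (f (vbas i)) : 'M_(dim V).
have ME x : v2r (f x) = v2r x *m M.
  rewrite (vbas_lin x fL) linear_sum mulmx_sum_row; apply: eq_bigr => i _.
  by rewrite linearZ; congr (_ *: _); apply/rowP => j; rewrite !mxE.
have [s [ss cs ts]] := spectrum M.
have eigP a : reflect (exists2 x, x != 0 & f x = a *: x) (a \in s).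
  have -> : (a \in s) = root (char_poly M) a.
    by rewrite cs root_prod_XsubC.
  rewrite -eigenvalue_root_char; apply: (iffP eigenvalueP) => [[v vM v0]|[x x0
    fx]].
    exists (r2v v); first by apply: contraNneq v0 => v0;
      rewrite -[v]r2vK v0 linear0.
    by apply: v2r_inj; rewrite ME r2vK vM linearZ /= r2vK.
  exists (v2r x); first by rewrite -ME fx linearZ.
  by apply: contraNneq x0 => x0; rewrite -[x]v2rK x0 linear0.
exists s; split; [by rewrite ss dimvf | | by move=> a /eigP |
  by move=> a x x0 fx; apply/eigP; exists x].
move=> k; rewrite -ts.
have MEk x : v2r (iter k f x) = v2r x *m iter k (mulmx M) 1%:M.
  elim: k x => [|k IHk] x; first by rewrite mulmx1.
  by rewrite iterSr IHk ME mulmxA.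
apply: eq_bigr => i _; rewrite /vcoef MEk /vbas r2vK -rowE mxE.
by [].
Qed.

(** * Semisimple algebras *)

Lemma ker_vspace (K : fieldType) (U W : vectType K) (f : U -> W) : linear f ->
  exists V : {vspace U}, forall x, (x \in V) = (f x == 0).
Proof.
move=> fL; pose g : {linear U -> W} := HB.pack f (GRing.isLinear.Build _ _ _ _
  _ fL).
by exists (lker (linfun g)) => x; rewrite memv_ker lfunE.
Qed.

Lemma ltn_dimv (K : fieldType) (V : vectType K) (U W : {vspace V}) x :
  (U <= W)%VS -> x \in W -> x \notin U -> (\dim U < \dim W)%N.
Proof.
move=> UW xW xU; rewrite ltnNge; apply: contra xU => WU.
by have /eqP -> : U == W by rewrite eqEdim UW.
Qed.

Section SemisimpleAlgebra.
Variables (K : fieldType) (A : falgType K) (A_ss : semisimple A).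
Implicit Types (U : {vspace A}) (x y e : A).

(** Split [1 = e + e'] along an invariant complement; for [x] in [U], the product [x * e'] lies in
    both summands. *)
Lemma left_ideal_idem U : (forall a u, u \in U -> a * u \in U) ->
  exists2 e, e \in U & {in U, forall x, x * e = x}.
Proof.
move=> UI; have [U' [U'I sUU' cUU']] := A_ss (U := U) UI.
have : (1 : A) \in (U + U')%VS by rewrite sUU' memvf.
case/memv_addP => e eU [e' e'U' e1]; exists e => // x xU.
have xe' : x = x * e + x * e' by rewrite -mulrDr -e1 mulr1.
suff: x * e' \in (U :&: U')%VS by rewrite cUU' memv0 => /eqP z;
  rewrite [RHS]xe' z addr0.
rewrite memv_cap (U'I x e') // andbT.
have -> : x * e' = x - x * e by rewrite {2}xe' [_ + x * e']addrC addrK.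
by rewrite rpredB // UI.
Qed.

Lemma left_ideal_sqr0 U : (forall a u, u \in U -> a * u \in U) ->
  {in U &, forall x y, x * y = 0} -> {in U, forall x, x = 0}.
Proof.
move=> UI U0 x xU; have [e eU eE] := left_ideal_idem UI.
by rewrite -(eE _ xU) U0.
Qed.

Definition central x := forall y, x * y = y * x.

(** The part of [U] killed by left multiplication by the right unit [e] is a left ideal of square
    zero, so [e] is a unit of [U] on both sides; then [a e = e a e = e a]. *)
Lemma ideal_idem U : (forall a u, u \in U -> a * u \in U) ->
    (forall a u, u \in U -> u * a \in U) ->
  exists e, [/\ e \in U, {in U, forall x, x * e = x} & central e].
Proof.
move=> UIl UIr; have [e eU eE] := left_ideal_idem UIl; exists e; split=> //.
have [J JE] : exists J : {vspace A}, forall x, (x \in J) = (e * x == 0).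
  by apply: ker_vspace => a x y; rewrite mulrDr -scalerAr.
have e0 : {in U, forall x, e * x = x}.
  move=> x xU; apply/eqP; rewrite eq_sym -subr_eq0; apply/eqP.
  have ee : e * e = e by exact: eE.
  apply: (@left_ideal_sqr0 (U :&: J)%VS) => [a u|u v|].
  - rewrite !memv_cap !JE => /andP[uU /eqP eu]; rewrite UIl // mulrA.
    by rewrite -(eE (e * a)) ?UIr // -mulrA eu mulr0 eqxx.
  - rewrite !memv_cap !JE => /andP[uU _] /andP[_ /eqP ev].
    by rewrite -(eE u uU) -mulrA ev mulr0.
  by rewrite memv_cap JE mulrBr mulrA ee subrr eqxx andbT rpredB // UIl.
by move=> a; rewrite -[RHS]e0 ?UIl // mulrA eE // UIr.
Qed.

End SemisimpleAlgebra.

Lemma ltrace_idem (K : fieldType) (V : vectType K) (f : V -> V) : linear f ->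
    (forall x, f (f x) = f x) ->
  exists2 U : {vspace V}, ltrace f = (\dim U)%:R & forall x, (x \in U) =
    (f x == x).
Proof.
move=> fL ff; have [U UE] : exists U : {vspace V}, forall x, (x \in U) =
  (f x - x == 0).
  by apply: ker_vspace => a x y; rewrite fL scalerBr opprD addrACA.
exists U => [|x]; last by rewrite UE subr_eq0.
apply: ltrace_proj => // [x|x]; first by rewrite UE ff subrr.
by rewrite UE subr_eq0 => /eqP.
Qed.

(** * The regular trace form and its Casimir element *)

Section TraceForm.
Variables (K : fieldType) (A : falgType K).
Implicit Types (x y e : A).

Definition regtrace x := ltrace (fun y => x * y).

Lemma mull_linear x : linear (fun y => x * y).
Proof. by move=> a u v; rewrite mulrDr -scalerAr. Qed.

Lemma mulr_linear x : linear (fun y => y * x).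
Proof. by move=> a u v; rewrite mulrDl -scalerAl. Qed.

Lemma regtrace_linear : scalar regtrace.
Proof.
move=> a x y; rewrite /regtrace -ltraceZ -ltraceD; apply: eq_ltrace => z.
by rewrite mulrDl -scalerAl.
Qed.

Lemma regtraceC x y : regtrace (x * y) = regtrace (y * x).
Proof.
have E a b : regtrace (a * b) = ltrace ((fun z => a * z) \o (fun z => b * z)).
  by apply: eq_ltrace => z /=; rewrite mulrA.
by rewrite !E ltrace_comp //; exact: mull_linear.
Qed.

Lemma regtrace_idem e : e * e = e -> exists2 d :
  nat, regtrace e = d%:R & d = 0%N -> e = 0.
Proof.
move=> ee; have [|U tU UE] := ltrace_idem (mull_linear e); first by move=> x;
  rewrite mulrA ee.
exists (\dim U) => // /eqP; rewrite dimv_eq0 => /eqP U0.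
by have := UE e; rewrite ee eqxx U0 memv0 => /eqP.
Qed.

End TraceForm.

Section CasimirElement.
Variables (K : fieldType) (K0 : [pchar K] =i pred0).
Variables (A : falgType K) (A_ss : semisimple A).
Implicit Types (x y e : A).
Local Notation t := (@regtrace K A).

Lemma regtrace_sum (I : Type) (r : seq I) (P : pred I) (F : I -> A) :
  t (\sum_(i <- r | P i) F i) = \sum_(i <- r | P i) t (F i).
Proof. exact: (linear_fun_sum _ _ _ (@regtrace_linear K A : linear (t : A ->
  K^o))). Qed.

Lemma regtraceZ a x : t (a *: x) = a * t x.
Proof. exact: (linear_funZ _ _ (@regtrace_linear K A : linear (t : A ->
  K^o))). Qed.

(** The radical of the form is a two-sided ideal, hence generated by an idempotent [e] of trace
    zero. In characteristic zero the rank of multiplication by [e] is then zero. *)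
Lemma regtrace_nondegenerate x : (forall y, t (x * y) = 0) -> x = 0.
Proof.
move=> tx.
have [U UE] : exists U : {vspace A}, forall x, (x \in U) =
  (\row_i t (x * vbas i) == 0).
  apply: ker_vspace => a u v; apply/rowP => i; rewrite !mxE.
  by rewrite mulrDl -scalerAl regtrace_linear.
have UP u : reflect (forall y, t (u * y) = 0) (u \in U).
  rewrite UE; apply: (iffP eqP) => [/rowP u0 y|u0]; last by apply/rowP => i;
    rewrite !mxE.
  rewrite [y]vbas_sum mulr_sumr regtrace_sum big1 // => i _.
  by rewrite -scalerAr regtraceZ; have := u0 i; rewrite !mxE => ->;
    rewrite mulr0.
have [a u /UP u0|a u /UP u0|e [eU eE _]] := @ideal_idem _ _ A_ss U.
- by apply/UP => y; rewrite -mulrA regtraceC -mulrA.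
- by apply/UP => y; rewrite -mulrA.
have [d td d0] := regtrace_idem (eE _ eU).
have e0 : e = 0.
  apply: d0; apply/eqP; have /pcharf0P <- := K0.
  by rewrite -td -[e]mulr1; move/UP: eU => ->.
have /eE <- : x \in U by apply/UP.
by rewrite e0 mulr0.
Qed.

Lemma dual_basis : exists x_ : 'I_(dim A) ->
  A, forall i j, t (x_ i * vbas j) = (i == j)%:R.
Proof.
pose G := \matrix_(i, j) t ((vbas i : A) * vbas j) : 'M_(dim A).
have uG : G \in unitmx.
  rewrite -row_free_unit -kermx_eq0; apply/rowV0P => v /sub_kermxP vG.
  have x0 : \sum_i v 0 i *: vbas i = 0 :> A.
    apply: regtrace_nondegenerate => y;
      rewrite [y]vbas_sum mulr_sumr regtrace_sum big1 // => j _.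
    rewrite -scalerAr regtraceZ mulr_suml regtrace_sum.
    have /rowP/(_ j) := vG; rewrite !mxE => Ej.
    rewrite (eq_bigr (fun i => v 0 i * G i j)) ?Ej ?mulr0 // => i _.
    by rewrite -scalerAl regtraceZ mxE.
  apply/rowP => i; rewrite mxE; have := congr1 (vcoef i) x0.
  have cL : linear (vcoef i : A -> K^o) by exact: vcoef_linear.
  rewrite (linear_fun_sum _ _ _ cL) (linear_fun0 cL) (bigD1 i) //= (linear_funZ
    _ _ cL) vcoef_vbas eqxx.
  rewrite big1 => [|j ji]; first by rewrite addr0 [_ *: _]mulr1.
  by rewrite (linear_funZ _ _ cL) vcoef_vbas (negbTE ji) scaler0.
exists (fun k => \sum_i invmx G k i *: vbas i) => k j.
have /matrixP/(_ k j) := mulVmx uG; rewrite !mxE => <-.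
rewrite mulr_suml regtrace_sum; apply: eq_bigr => i _.
by rewrite -scalerAl regtraceZ mxE.
Qed.

Definition dual_vbas := sval (cid dual_basis).

Lemma regtrace_dual_vbas i j : t (dual_vbas i * vbas j) = (i == j)%:R.
Proof. by rewrite /dual_vbas; case: cid. Qed.

Lemma vcoef_regtrace k y : vcoef k y = t (dual_vbas k * y).
Proof.
rewrite [y in RHS]vbas_sum mulr_sumr regtrace_sum (bigD1 k) //= -scalerAr
  regtraceZ regtrace_dual_vbas eqxx.
rewrite mulr1 big1 ?addr0 // => j jk.
by rewrite -scalerAr regtraceZ regtrace_dual_vbas eq_sym (negbTE jk) mulr0.
Qed.

Lemma regtrace_ext x y : (forall z, t (x * z) = t (y * z)) -> x = y.
Proof.
move=> xy; apply/eqP; rewrite -subr_eq0; apply/eqP;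
  apply: regtrace_nondegenerate => z.
rewrite mulrBl -scaleN1r addrC.
by rewrite (regtrace_linear (-1)) xy mulN1r addNr.
Qed.

Lemma regtrace_vbas_ext x y : (forall k, t (x * vbas k) = t (y * vbas k)) ->
  x = y.
Proof.
move=> xy; apply: regtrace_ext; apply: vbas_ext_scalar => // a u v.
  by rewrite mulrDr -scalerAr regtrace_linear.
by rewrite mulrDr -scalerAr regtrace_linear.
Qed.

Lemma regtrace_riesz (phi : A -> K) :
  scalar phi -> exists w, forall x, phi x = t (w * x).
Proof.
move=> phiL; exists (\sum_k phi (vbas k) *: dual_vbas k);
  apply: vbas_ext_scalar => // [a u v|j].
  by rewrite mulrDr -scalerAr regtrace_linear.
rewrite mulr_suml regtrace_sum (bigD1 j) //= -scalerAl regtraceZ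
  regtrace_dual_vbas eqxx mulr1.
rewrite big1 ?addr0 // => k kj.
by rewrite -scalerAl regtraceZ regtrace_dual_vbas (negbTE kj) mulr0.
Qed.

Lemma dual_vbas_sum y : y = \sum_k t (y * vbas k) *: dual_vbas k.
Proof.
apply: regtrace_vbas_ext => j.
rewrite mulr_suml regtrace_sum (bigD1 j) //= -scalerAl regtraceZ
  regtrace_dual_vbas eqxx mulr1.
rewrite big1 ?addr0 // => k kj.
by rewrite -scalerAl regtraceZ regtrace_dual_vbas (negbTE kj) mulr0.
Qed.

(** The average of [y] by the Casimir element of the trace form, a projection-like map to the
    centre. *)
Definition casimir y := \sum_k vbas k * y * dual_vbas k.

Lemma casimir_central y : central (casimir y).
Proof.
move=> a; rewrite /casimir mulr_suml mulr_sumr.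
transitivity (\sum_k \sum_j t (dual_vbas k * a * vbas j) *: (vbas k * y *
  dual_vbas j)).
  apply: eq_bigr => k _; rewrite -mulrA {1}[dual_vbas k * a]dual_vbas_sum
    mulr_sumr.
  by apply: eq_bigr => j _; rewrite scalerAr.
rewrite exchange_big; apply: eq_bigr => j _ /=.
rewrite !mulrA [a * vbas j]vbas_sum !mulr_suml; apply: eq_bigr => k _.
by rewrite vcoef_regtrace -!scalerAl mulrA.
Qed.

Lemma ltrace_lr x y : ltrace (fun z => x * z * y) = t (casimir y * x).
Proof.
rewrite /casimir mulr_suml regtrace_sum; apply: eq_bigr => k _.
by rewrite vcoef_regtrace regtraceC -mulrA -mulrA regtraceC -!mulrA.
Qed.

(** This normalization holds because [t] is the regular trace: [t x] is the trace of
    [z |-> x * z * 1], that is [t (casimir 1 * x)]. *)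
Lemma casimir1 : casimir 1 = 1.
Proof.
apply: regtrace_ext => x; rewrite -ltrace_lr mul1r; apply: eq_ltrace => z;
  exact: mulr1.
Qed.

(** Symmetry of [t] allows the two factors of the Casimir element to be exchanged; this is what
    identifies left and right regular traces. *)
Lemma casimir1_op : \sum_k dual_vbas k * vbas k = 1 :> A.
Proof.
rewrite -casimir1 /casimir.
transitivity (\sum_k \sum_j t (vbas k * vbas j) *: (dual_vbas k * dual_vbas j)).
  apply: eq_bigr => k _; rewrite {1}[vbas k in LHS]dual_vbas_sum mulr_sumr.
  by apply: eq_bigr => j _; rewrite -scalerAr.
rewrite exchange_big; apply: eq_bigr => j _ /=.
rewrite mulr1 {2}[vbas j]dual_vbas_sum mulr_suml; apply: eq_bigr => k _.
by rewrite -scalerAl regtraceC.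
Qed.

Lemma ltrace_mulr y : ltrace (fun z : A => z * y) = t y.
Proof.
transitivity (\sum_k t (dual_vbas k * vbas k * y)).
  by apply: eq_bigr => k _; rewrite vcoef_regtrace mulrA.
by rewrite -regtrace_sum -mulr_suml casimir1_op mul1r.
Qed.

End CasimirElement.

(** * Central idempotents and the trace of two-sided multiplications *)

Section CentralIdempotents.
Variables (K : closedFieldType) (K0 : [pchar K] =i pred0).
Variables (A : falgType K) (A_ss : semisimple A).
Implicit Types (x y e f : A).
Local Notation t := (@regtrace K A).

Definition central_idem e := central e /\ e * e = e.
(** The last clause, that the centre acts on the block of [e] by scalars, expresses
    indecomposability over a closed field in the form in which it is used. *)
Definition primitive e := [/\ central_idem e, e != 0
  & forall c, central c -> exists a, c * e = a *: e].

Lemma centralM x y : central x -> central y -> central (x * y).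
Proof. by move=> cx cy z; rewrite -mulrA cy mulrA cx -mulrA. Qed.

Lemma fixv_vspace e : exists U : {vspace A}, forall x, (x \in U) = (e * x == x).
Proof.
have [|U UE] := @ker_vspace _ _ _ (fun x => e * x - x).
  by move=> a x y; rewrite mulrDr -scalerAr scalerBr opprD addrACA.
by exists U => x; rewrite UE subr_eq0.
Qed.
Definition fixv e := sval (cid (fixv_vspace e)).
Lemma fixvE e x : (x \in fixv e) = (e * x == x).
Proof. by rewrite /fixv; case: cid. Qed.

(** On [e A] the element [c] has an eigenvector [x], with eigenvalue [a]. The central element
    [c1 = c e - a e] is nonzero and kills [x], so the central idempotent generating [A c1] is a
    proper nonzero part of [e]. *)
Lemma split_central e c : central_idem e -> e != 0 -> central c ->
    (forall a, c * e != a *: e) ->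
  exists f, [/\ central_idem f, e * f = f & (\dim (fixv f) < \dim (fixv e))%N
     /\ (\dim (fixv (e - f)%R) < \dim (fixv e))%N].
Proof.
move=> [ce ee] e0 cc cNe.
have eU : e \in fixv e by rewrite fixvE ee.
pose g (u : subvs_of (fixv e)) : subvs_of (fixv e) := vsproj (fixv e) (c *
  vsval u).
have gL : linear g by move=> a u v; rewrite /g linearP mulrDr -scalerAr linearP.
have [s [ss _ sP _]] := ltrace_spectrum gL.
have : (0 < size s)%N.
  rewrite ss dimvf; change (0 < \dim (fixv e))%N.
  by rewrite lt0n dimv_eq0; apply: contraNneq e0 => U0; rewrite U0 memv0 in eU.
case: s sP {ss} => // a s /(_ a (mem_head _ _))[u u0 gu] _.
pose x := vsval u; have /eqP ex : e * x == x by rewrite -fixvE subvsP.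
have x0 : x != 0 by apply: contraNneq u0 => x0; apply/eqP/subvs_inj;
  rewrite linear0.
have cx : c * x = a *: x.
  have := congr1 vsval gu; rewrite /g vsprojK ?linearZ //.
  by rewrite fixvE mulrA -cc -mulrA ex.
pose c1 := c * e - a *: e.
have c1c : central c1.
  by move=> y; rewrite /c1 mulrBl mulrBr -scalerAl -scalerAr ce centralM.
have c10 : c1 != 0 by rewrite subr_eq0.
have c1e : c1 * e = c1 by rewrite /c1 mulrBl -scalerAl -mulrA ee.
have c1x : c1 * x = 0 by rewrite /c1 mulrBl -scalerAl -mulrA ex cx subrr.
pose I := limg (amulr c1).
have IP y : reflect (exists z, y = z * c1) (y \in I).
  apply: (iffP memv_imgP) => [[z _ ->]|[z ->]]; exists z; rewrite ?memvf //.
    by rewrite lfunE.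
  by rewrite lfunE.
have [b v /IP[z ->]|b v /IP[z ->]|f [fI fE fc]] := @ideal_idem _ _ A_ss I.
- by apply/IP; exists (b * z); rewrite mulrA.
- by apply/IP; exists (z * b); rewrite -!mulrA c1c.
have c1f : c1 * f = c1 by apply: fE; apply/IP; exists 1; rewrite mul1r.
have [y fy] := IP _ fI.
have fx : f * x = 0 by rewrite fy -mulrA c1x mulr0.
have ef : e * f = f by rewrite fy ce -mulrA c1e.
have f0 : f != 0 by apply: contraNneq c10 => f0; rewrite -c1f f0 mulr0.
have ff : f * f = f by exact: fE.
have efU g' : e * g' = g' -> (fixv g' <= fixv e)%VS.
  by move=> eg; apply/subvP => z; rewrite !fixvE => /eqP zE;
    rewrite -zE mulrA eg.
exists f; split=> //; split.
  by apply: (@ltn_dimv _ _ _ _ x); rewrite ?efU ?fixvE ?ex ?fx // eq_sym.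
apply: (@ltn_dimv _ _ _ _ f); first by rewrite efU // mulrBr ee ef.
  by rewrite fixvE ef.
by rewrite fixvE mulrBl ef ff subrr eq_sym.
Qed.

Lemma primitive_decomposition e : central_idem e ->
  exists2 s : seq A, e = \sum_(f <- s) f & forall f, f \in s -> primitive f.
Proof.
have [d] := ubnP (\dim (fixv e)); elim: d e => // d IHd e le_d [ce ee].
have [->|e0] := eqVneq e 0; first by exists [::]; rewrite ?big_nil.
have [pe|npe] := pselect (forall c, central c -> exists a, c * e = a *: e).
  by exists [:: e] => [|f]; rewrite ?big_seq1 // inE => /eqP ->.
have [c /not_implyP[cc /forallNP ca]] := (existsNP _).2 npe.
have [f [[fc ff] ef [lt_f lt_ef]]] := split_central (conj ce ee) e0 cc (fun a
  => introN eqP (ca a)).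
have fe : f * e = f by rewrite fc.
have [s1 fs1 s1P] := IHd f (leq_trans lt_f le_d) (conj fc ff).
have [||s2 fs2 s2P] := IHd (e - f); first exact: leq_trans lt_ef le_d.
  by split=> [y|]; [rewrite mulrBl mulrBr ce fc | rewrite mulrBl !mulrBr ee ef
    fe ff subrr subr0].
exists (s1 ++ s2) => [|h]; first by rewrite big_cat -fs1 -fs2 /= addrC subrK.
by rewrite mem_cat => /orP[/s1P|/s2P].
Qed.

(** On a block of N x N matrices [t] is N times the matrix trace and [t e = N^2], so each summand is
    the product of the matrix traces of [x] and [y]. No block is identified with a matrix algebra:
    [casimir y] acts on it as the scalar [t (y * e) / t e]. *)
Lemma ltrace_lr_sum (s : seq A) x y : 1 = \sum_(e <- s) e ->
    (forall e, e \in s -> primitive e) ->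
  ltrace (fun z => x * z * y) = \sum_(e <- s) t (x * e) * t (y * e) / t e.
Proof.
move=> s1 sP; rewrite (ltrace_lr K0 A_ss) -[casimir _ _ _]mulr1 s1 mulr_sumr
  mulr_suml.
rewrite (regtrace_sum _ _ _) big_seq [RHS]big_seq;
  apply: eq_bigr => e /sP[[ce ee] e0 eP].
have [a Ea] := eP _ (casimir_central K0 A_ss y).
have [d td d0] := regtrace_idem ee.
have te0 : t e != 0.
  rewrite td; have /pcharf0P -> := K0; apply: contra_neq e0; exact: d0.
have : a * t e = t (y * e).
  rewrite -regtraceZ -Ea -(ltrace_lr K0 A_ss) -(ltrace_mulr K0 A_ss);
    apply: eq_ltrace => z.
  by rewrite ce -mulrA -ce.
rewrite Ea -scalerAl regtraceZ regtraceC => <-.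
by rewrite mulrA mulfK // mulrC regtraceC.
Qed.

End CentralIdempotents.

(** * Sums of roots of unity *)

Section RootsOfUnity.
Variables (K : fieldType) (K0 : [pchar K] =i pred0).

(** A common root in K makes the integer resultant vanish, since the characteristic is zero; then
    [p] and [q] have a nonconstant common divisor over the integers, which has a root in [algC]. *)
Lemma common_root_algC (p q : {poly int}) (z : K) : p != 0 ->
    root (map_poly intr p) z -> root (map_poly intr q) z ->
  exists2 x : algC, root (map_poly intr p) x & root (map_poly intr q) x.
Proof.
move=> p0 /rootP pz /rootP qz.
have [sp|sp] := leqP (size p) 1.
  move: pz; rewrite (size1_polyC sp) map_polyC hornerC /= => /eqP.
  by rewrite (intf_eq0 K0) => /eqP c0; case/eqP: p0;
    rewrite (size1_polyC sp) c0.
have [sq|sq] := leqP (size q) 1.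
  move: qz; rewrite (size1_polyC sq) map_polyC hornerC /= => /eqP.
  rewrite (intf_eq0 K0) => /eqP ->.
  have /closed_rootP[x px] : size (map_poly intr p : {poly algC}) != 1.
    by rewrite size_map_inj_poly ?rmorph0 //;
      [rewrite gtn_eqF | exact: intr_inj].
  by exists x => //; rewrite rmorph0 root0.
have res0 : resultant p q == 0.
  have [[u v] _ uv] := resultant_in_ideal sp sq.
  have /(congr1 (fun r : {poly int} => (map_poly intr r).[z])) := uv.
  rewrite map_polyC hornerC /= rmorphD !rmorphM /= hornerD !hornerM pz qz
    !mulr0 addr0.
  by move/eqP; rewrite (intf_eq0 K0).
move: res0; rewrite resultant_eq0 => sg; pose g := gcdp p q.
have /closed_rootP[x gx] : size (map_poly intr g : {poly algC}) != 1.
  by rewrite size_map_inj_poly ?rmorph0 //; [rewrite gtn_eqF | exact: intr_inj].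
have rootx r : g %| r -> root (map_poly intr r) x.
  case/Pdiv.Idomain.dvdpP => -[c u] /= c0 /(congr1 (map_poly (intr : int ->
    algC))).
  rewrite map_polyZ rmorphM /= => /(congr1 (horner^~ x));
    rewrite hornerZ hornerM.
  rewrite (rootP gx) mulr0 => /eqP; rewrite mulf_eq0 intr_eq0 (negbTE c0) /=.
  by rewrite /root.
by exists x; apply: rootx; [exact: dvdp_gcdl | exact: dvdp_gcdr].
Qed.

(* Over the complex numbers each summand is [c |sum_k z ^ k| ^ 2 >= 0]. *)
Lemma unity_root_sum_neq0 M d (s : seq (nat * seq nat)) (z : K) :
    (0 < M)%N -> (0 < d)%N -> z ^+ M = 1 ->
  d%:R + \sum_(cl <- s) cl.1%:R *
     ((\sum_(k <- cl.2) z ^+ k) * \sum_(k <- cl.2) (z ^+ (2 * M).-1) ^+ k) != 0.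
Proof.
move=> M0 d0 zM; apply/eqP => E.
pose q : {poly int} := d%:R%:P + \sum_(cl <- s) cl.1%:R%:P *
  ((\sum_(k <- cl.2) 'X^k) * \sum_(k <- cl.2) 'X^((2 * M).-1 * k)).
pose p : {poly int} := 'X^M - 1.
have qE (R : comNzRingType) (x : R) : (map_poly intr q).[x] =
  d%:R + \sum_(cl <- s) cl.1%:R *
   ((\sum_(k <- cl.2) x ^+ k) * \sum_(k <- cl.2) (x ^+ (2 * M).-1) ^+ k).
  rewrite rmorphD /= map_polyC /= rmorph_nat hornerD hornerC; congr (_ + _).
  rewrite rmorph_sum horner_sum; apply: eq_bigr => cl _.
  rewrite !rmorphM /= !hornerM map_polyC /= rmorph_nat hornerC; congr (_ * _).
  rewrite !rmorph_sum !horner_sum.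
  congr (_ * _); apply: eq_bigr => k _; rewrite /= map_polyXn hornerXn //.
  by rewrite exprM.
have pE (R : comNzRingType) (x : R) : (map_poly intr p).[x] = x ^+ M - 1.
  by rewrite rmorphB rmorph1 /= map_polyXn hornerD hornerN hornerXn hornerC.
have [||| x] := @common_root_algC p q z.
- by rewrite -size_poly_gt0 size_XnsubC.
- by apply/rootP; rewrite pE zM subrr.
- by apply/rootP; rewrite qE.
move=> /rootP; rewrite pE => /eqP; rewrite subr_eq0 => /eqP xM /rootP.
rewrite qE; apply/eqP; rewrite gt_eqF // ltr_pwDl ?ltr0n // sumr_ge0 // => cl _.
rewrite mulr_ge0 ?ler0n //.
have -> : x ^+ (2 * M).-1 = x^*.
  have nx : `|x| = 1 by apply/eqP; rewrite -(pexpr_eq1 M0) // -normrX xM normr1.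
  have x0 : x != 0 by rewrite -normr_eq0 nx oner_eq0.
  apply: (mulfI x0); rewrite -normCK nx expr1n -exprS prednK ?muln_gt0 //.
  by rewrite mulnC exprM xM expr1n.
under [X in _ * X]eq_bigr do rewrite -rmorphXn.
by rewrite -rmorph_sum mul_conjC_ge0.
Qed.

Lemma exists_prim_root (F : closedFieldType) M :
  [pchar F] =i pred0 -> (0 < M)%N ->
  exists z : F, M.-primitive_root z.
Proof.
move=> F0 M0; have [rs rsE] := closed_field_poly_normal ('X^M - 1 : {poly F}).
have pm : ('X^M - 1 : {poly F}) \is monic by exact: monicXnsubC.
rewrite (monicP pm) scale1r in rsE.
have Mn : (M%:R != 0 :> F) by have /pcharf0P -> := F0; rewrite -lt0n.
have Urs : uniq rs.
  by rewrite -separable_prod_XsubC -rsE separable_Xn_sub_1.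
have rsM : (M <= size rs)%N by rewrite -ltnS -(size_prod_XsubC rs id) -rsE
  size_XnsubC.
have rs1 : all M.-unity_root rs.
  apply/allP => x xr; rewrite unity_rootE -subr_eq0.
  by move: xr; rewrite -root_prod_XsubC -rsE /root !hornerE.
by have /hasP[z _ zP] := has_prim_root M0 rs1 Urs rsM; exists z.
Qed.
End RootsOfUnity.

Section InnerTrace.
Variables (K : closedFieldType) (K0 : [pchar K] =i pred0).
Variables (A : falgType K) (A_ss : semisimple A).
Variables (w v : A) (M : nat).
Hypotheses (wv : w * v = 1) (vw : v * w = 1) (M0 : (0 < M)%N) (cwM :
  central (w ^+ M)).
Local Notation t := (@regtrace K A).
Variables (z : K) (z_prim : M.-primitive_root z).

(** If [r ^+ M] is the scalar by which [w ^+ M] acts on the block, the nonzero eigenvalues of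
    [w / r] there are powers of [z]; the factors [r] and [r^-1] from [w] and [v] cancel. The
    exponent [(2 * M).-1] stands for -1: the zero eigenvalues from outside the block drop out only
    in positive powers, and [M.-1] is 0 for [M = 1]. *)
Lemma block_trace e : primitive e -> exists l : seq nat,
  t (w * e) * t (v * e) = (\sum_(k <- l) z ^+ k) * \sum_(k <- l) (z ^+ (2 *
    M).-1) ^+ k.
Proof.
move=> [[ce ee] e0 eP]; have [a wMe] := eP _ cwM.
have cwv : v ^+ M * w ^+ M = 1.
  by rewrite -exprMn_comm ?vw ?expr1n // /GRing.comm vw wv.
have a0 : a != 0.
  apply: contraNneq e0 => a0; rewrite -[e]mul1r -cwv -mulrA wMe a0 scale0r.
  by rewrite mulr0.
have [r rM] : exists r, r ^+ M = a.
  have [|r] := closed_rootP ('X^M - a%:P) _;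
    first by rewrite size_XnsubC // eqSS -lt0n.
  by rewrite /root !hornerE subr_eq0 => /eqP rM; exists r.
have r0 : r != 0 by apply: contraNneq a0 => r0;
  rewrite -rM r0 expr0n eqn0Ngt M0.
pose f y := r^-1 *: (w * e * y).
have fL : linear f.
  by move=> b x y; rewrite /f mulrDr -scalerAr scalerDr !scalerA mulrC.
have iterf k y : iter k.+1 f y = r^-1 ^+ k.+1 *: (w ^+ k.+1 * e * y).
  elim: k => [|k IHk]; first by rewrite !expr1.
  rewrite iterS IHk /f -scalerAr scalerA -exprS; congr (_ *: _).
  by rewrite [w ^+ k.+2]exprS -!mulrA; congr (_ * _);
    rewrite (mulrA e (w ^+ _)) (ce (w ^+ _)) -(mulrA (w ^+ _)) (mulrA e e) ee.
have iterM y : iter M f y = e * y.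
  by rewrite -(prednK M0) iterf prednK // wMe -scalerAl scalerA -rM -exprMn
    mulVf // expr1n scale1r.
have [s [_ st sP _]] := ltrace_spectrum fL.
have sM x : x \in s -> x != 0 -> x ^+ M = 1.
  move=> /sP[y y0 fy] x0.
  have ey : e * y = y.
    apply: (scalerI x0); rewrite -fy scalerAr -fy /f -scalerAr.
    by rewrite [e * _]mulrA (mulrA e w) (ce w) -(mulrA w e e) ee.
  have /eqP : x ^+ M *: y = 1 *: y.
    rewrite scale1r -[RHS]ey -iterM; elim: (M) => [|k IHk];
      first by rewrite scale1r.
    by rewrite /= -IHk (linear_funZ _ _ fL) fy scalerA exprSr.
  by rewrite -subr_eq0 -scalerBl scaler_eq0 (negbTE y0) orbF subr_eq0 => /eqP.
have [l lE] : exists l : seq nat, forall j, (0 < j)%N ->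
    \sum_(x <- s) x ^+ j = \sum_(k <- l) (z ^+ k) ^+ j.
  elim: s sM {st sP} => [|x s IHs] sM.
    by exists [::] => j _; rewrite !big_nil.
  have [|l lE] := IHs; first by move=> y ys; apply: sM; rewrite inE ys orbT.
  have [x0|x0] := eqVneq x 0.
    exists l => j j0; rewrite big_cons lE // x0 expr0n.
    by rewrite eqn0Ngt j0 add0r.
  have [i ->] := prim_rootP z_prim (sM x (mem_head _ _) x0).
  by exists (nat_of_ord i :: l) => j j0; rewrite !big_cons lE.
have twe : t (w * e) = r * \sum_(x <- s) x ^+ 1.
  by rewrite -st -[iter 1 f]/(fun y => r^-1 *: (w * e * y)) ltraceZ mulVKf.
have tve : t (v * e) = r^-1 * \sum_(x <- s) x ^+ (2 * M).-1.
  have M2 : ((2 * M).-1 = (2 * M).-2.+1)%N by move: M0; case: (M) => // m _;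
    rewrite mulnS.
  have M2' : ((2 * M).-1.+1 = M + M)%N by move: M0; case: (M) => // m _;
    rewrite mul2n -addnn.
  rewrite -st M2 (eq_ltrace (iterf _)) -M2 -ltraceZ; apply: eq_ltrace => y;
    rewrite scalerA.
  have -> : w ^+ (2 * M).-1 * e = r ^+ (M + M) *: (v * e).
    rewrite -[w ^+ _]mul1r -vw -[v * w * _]mulrA -exprS M2' exprD -!mulrA wMe.
    rewrite mulrA -!scalerAr -mulrA wMe -scalerAr scalerA.
    by rewrite exprD rM.
  rewrite -M2' -scalerAl scalerA -exprS exprVn mulVf ?scale1r //.
  by rewrite expf_neq0.
exists l; rewrite twe tve mulrACA mulfV // mul1r !lE //; last by move: M0;
  case: (M) => // m _; rewrite mulnS.
by congr (_ * _); apply: eq_bigr => k _; rewrite exprAC.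
Qed.

(** Multiplying by the product [d] of the positive integers [t e] clears the denominators and leaves
    the natural weights required by [unity_root_sum_neq0]. *)
Lemma block_trace_sum (s : seq A) : (forall e, e \in s -> primitive e) ->
  exists2 d : nat, (0 < d)%N & exists cl : seq (nat * seq nat),
    d%:R * (\sum_(e <- s) t (w * e) * t (v * e) / t e) =
    \sum_(cl <- cl) cl.1%:R *
      ((\sum_(k <- cl.2) z ^+ k) * \sum_(k <- cl.2) (z ^+ (2 * M).-1) ^+ k).
Proof.
elim: s => [_|e s IHs sP]; first by exists 1%N => //; exists [::];
  rewrite !big_nil mulr0.
have [f fs|d d0 [cl E]] := IHs; first by apply: sP; rewrite inE fs orbT.
have pe := sP e (mem_head _ _).
have [l lE] := block_trace pe; have [[_ ee] e0 _] := pe.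
have [n tn n0] := regtrace_idem ee.
have n0' : (0 < n)%N by rewrite lt0n; apply: contra_neq e0; exact: n0.
exists (n * d)%N; first by rewrite muln_gt0 n0'.
exists ((d, l) :: [seq ((n * c.1)%N, c.2) | c <- cl]).
rewrite !big_cons /= big_map mulrDr; congr (_ + _).
  rewrite lE tn natrM [n%:R * _]mulrC -mulrA; congr (_ * _).
  by rewrite mulrC mulfVK //; have /pcharf0P -> := K0; rewrite -lt0n.
rewrite natrM -mulrA E mulr_sumr; apply: eq_bigr => c _.
by rewrite natrM [LHS]mulrA.
Qed.
End InnerTrace.

(* On every block [w] is a scalar multiple of an element of finite order, so the
   block contributes [|a| ^ 2 / N] with [a] a sum of roots of unity; the block
   [L] contributes a positive integer. *)
Lemma ltrace_inner_neq0 (K : closedFieldType) (K0 : [pchar K] =i pred0)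
    (A : falgType K) (A_ss : semisimple A) (w v L : A) (M : nat) :
    w * v = 1 -> v * w = 1 -> (0 < M)%N -> central (w ^+ M) ->
    central_idem L -> L != 0 -> (forall x, exists a, x * L = a *: L) ->
  ltrace (fun x => w * x * v) != 0.
Proof.
move=> wv vw M0 cwM [cL integral_idem] L0 LP.
have [z zP] := exists_prim_root K0 M0.
have pL : primitive L by split.
have c1L : central_idem (1 - L).
  split=> [y|]; first by rewrite mulrBl mulrBr mul1r mulr1 cL.
  by rewrite mulrBl !mulrBr !mul1r mulr1 integral_idem subrr subr0.
have [s s1 sP] := primitive_decomposition A_ss c1L.
have [d d0 [cl E]] := block_trace_sum K0 wv vw M0 cwM zP sP.
have [n tn n0] := regtrace_idem integral_idem.
have n0' : (0 < n)%N by rewrite lt0n; apply: contra_neq L0; exact: n0.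
rewrite (@ltrace_lr_sum _ K0 _ A_ss (L :: s)); first last.
- by move=> e; rewrite inE => /predU1P[->|/sP].
- by rewrite big_cons -s1 addrC subrK.
rewrite big_cons; have -> : regtrace (w * L) * regtrace (v * L) / regtrace L =
  n%:R.
  have [a wL] := LP w; have [b vL] := LP v.
  have ab : a * b = 1.
    apply/eqP; rewrite -subr_eq0; have : (a * b - 1) *: L == 0.
      rewrite scalerBl scale1r subr_eq0 mulrC -scalerA -wL scalerAr -vL.
      by rewrite mulrA wv mul1r.
    by rewrite scaler_eq0 (negbTE L0) orbF.
  have tL0 : regtrace L != 0 by rewrite tn; have /pcharf0P -> := K0;
    rewrite -lt0n.
  by rewrite wL vL !regtraceZ mulrACA ab mul1r mulfK.
apply/negP => /eqP D0; have dn : (0 < d * n)%N by rewrite muln_gt0 d0.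
have := unity_root_sum_neq0 K0 cl M0 dn (prim_expr_order zP).
by rewrite -E natrM -mulrDr D0 mulr0 eqxx.
Qed.

(** * Coproduct and antipode in coordinates *)

Section Tensors.
Variable K : fieldType.
Implicit Types U W X : vectType K.

Definition bilinear_map U W X (f : U -> W -> X) :=
  (forall w, linear (fun u => f u w)) /\ (forall u, linear (f u)).

Lemma tlift_sum U W X (f : U -> W -> X) I (r : seq I) (P : pred I) (u :
  I -> U) (w : I -> W) :
    bilinear_map f ->
  tlift f (\sum_(i <- r | P i) u i ⊗ w i) = \sum_(i <- r | P i) f (u i) (w i).
Proof.
move=> [fl fr]; rewrite (linear_fun_sum _ _ _ (tlift_is_linear f)).
by apply: eq_bigr => i _; rewrite tliftE.
Qed.

Lemma tpure0l U W (w : W) : (0 : U) ⊗ w = 0.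
Proof. exact: (linear_fun0 (tpure_linearl w)). Qed.

Lemma tpure0r U W (u : U) : u ⊗ (0 : W) = 0.
Proof. exact: (linear_fun0 (tpure_linearr u)). Qed.

Lemma tpureZl U W a (u : U) (w : W) : (a *: u) ⊗ w = a *: (u ⊗ w).
Proof. exact: (linear_funZ a u (tpure_linearl w)). Qed.

Lemma tpureZr U W a (u : U) (w : W) : u ⊗ (a *: w) = a *: (u ⊗ w).
Proof. exact: (linear_funZ a w (tpure_linearr u)). Qed.

Lemma tpure_suml U W I (r : seq I) (P : pred I) (u : I -> U) (w : W) :
  (\sum_(i <- r | P i) u i) ⊗ w = \sum_(i <- r | P i) u i ⊗ w.
Proof. exact: (linear_fun_sum _ _ _ (tpure_linearl w)). Qed.

Lemma tpure_sumr U W I (r : seq I) (P : pred I) (u : U) (w : I -> W) :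
  u ⊗ (\sum_(i <- r | P i) w i) = \sum_(i <- r | P i) u ⊗ w i.
Proof. exact: (linear_fun_sum _ _ _ (tpure_linearr u)). Qed.

Lemma tlift_param U W X (Y : lmodType K) (f : Y -> U -> W -> X) (t : tens U W) :
  (forall u w, linear (fun a => f a u w)) -> linear (fun a => tlift (f a) t).
Proof.
move=> fL a x y; rewrite /tlift scaler_sumr -big_split; apply: eq_bigr => i _.
rewrite scaler_sumr -big_split; apply: eq_bigr => j _.
by rewrite fL scalerDr !scalerA mulrC.
Qed.

End Tensors.

Section TensorMul.
Variables (K : fieldType) (A : falgType K).
Implicit Types s t u : tens A A.

Lemma bilinear_tmul_inner (a b : A) :
  bilinear_map (fun c d : A => (a * c) ⊗ (b * d)).
Proof.
split=> x k y z; first by rewrite mulrDr -scalerAr tpure_linearl.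
by rewrite mulrDr -scalerAr tpure_linearr.
Qed.

Lemma bilinear_tmul_outer t : bilinear_map
  (fun a b : A => tlift (fun c d => (a * c) ⊗ (b * d)) t).
Proof.
split=> x; apply: tlift_param => c d k y z.
  by rewrite mulrDl -scalerAl tpure_linearl.
by rewrite mulrDl -scalerAl tpure_linearr.
Qed.

Lemma tmul_linearl t : linear (fun s => tmul s t).
Proof. exact: tlift_is_linear. Qed.

Lemma tmul_linearr s : linear (tmul s).
Proof. by apply: tlift_param => a b; exact: tlift_is_linear. Qed.

Lemma tmul_pure (a b c d : A) : tmul (a ⊗ b) (c ⊗ d) = (a * c) ⊗ (b * d).
Proof.
rewrite /tmul tliftE; try by have [] := bilinear_tmul_outer (c ⊗ d).
by rewrite tliftE //; have [] := bilinear_tmul_inner a b.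
Qed.

Lemma tmulA : associative (@tmul K A).
Proof.
move=> s t u; move: s; apply: tens_ext => [||a b].
- by move=> k x y; rewrite tmul_linearl.
- by move=> k x y; rewrite !tmul_linearl.
move: t; apply: tens_ext => [||c d].
- by move=> k x y; rewrite tmul_linearl tmul_linearr.
- by move=> k x y; rewrite tmul_linearr tmul_linearl.
move: u; apply: tens_ext => [||e f].
- by move=> k x y; rewrite !tmul_linearr.
- by move=> k x y; rewrite tmul_linearr.
by rewrite !tmul_pure !mulrA.
Qed.

Lemma tmul1l : left_id (1 ⊗ 1) (@tmul K A).
Proof.
apply: tens_ext => [|//|a b]; first exact: tmul_linearr.
by rewrite tmul_pure !mul1r.
Qed.

Lemma tmul1r : right_id (1 ⊗ 1) (@tmul K A).
Proof.
apply: tens_ext => [|//|a b]; first exact: tmul_linearl.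
by rewrite tmul_pure !mulr1.
Qed.

Lemma tmulDl : left_distributive (@tmul K A) +%R.
Proof. by move=> s t u; rewrite (linear_funD _ _ (tmul_linearl u)). Qed.

Lemma tmulDr : right_distributive (@tmul K A) +%R.
Proof. by move=> s t u; rewrite (linear_funD _ _ (tmul_linearr s)). Qed.

End TensorMul.

(** A separate name keeps the product of the tensor algebra apart from matrix multiplication of the
    underlying coefficient matrices. *)
Definition talg (K : fieldType) (A : falgType K) : Type := tens A A.
HB.instance Definition _ (K : fieldType) (A : falgType K) := GRing.Lmodule.copy
  (@talg K A) (tens A A).
HB.instance Definition _ (K : fieldType) (A : falgType K) :=
  GRing.Zmodule_isPzRing.Build (talg A)
  (@tmulA K A) (@tmul1l K A) (@tmul1r K A) (@tmulDl K A) (@tmulDr K A).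
Definition tp (K : fieldType) (A : falgType K) (a b : A) : talg A := a ⊗ b.

Section TensorAlgebra.
Variables (K : fieldType) (A : falgType K).

Lemma tpM (a b c d : A) : tp a b * tp c d = tp (a * c) (b * d).
Proof. exact: tmul_pure. Qed.

Lemma tp_suml I (r : seq I) (P : pred I) (u : I -> A) (w : A) :
  tp (\sum_(i <- r | P i) u i) w = \sum_(i <- r | P i) tp (u i) w.
Proof. exact: tpure_suml. Qed.

Lemma tp_sumr I (r : seq I) (P : pred I) (u : A) (w : I -> A) :
  tp u (\sum_(i <- r | P i) w i) = \sum_(i <- r | P i) tp u (w i).
Proof. exact: tpure_sumr. Qed.

Lemma tpZ a (x y : A) : tp (a *: x) y = tp x (a *: y).
Proof. by rewrite /tp tpureZl tpureZr. Qed.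

Lemma tpZl a (x y : A) : tp (a *: x) y = a *: tp x y.
Proof. exact: tpureZl. Qed.

Definition contr (f g : A -> A) (s : talg A) : A := tlift (fun x y => f x * g
  y) s.

Section Contr.
Variables f g : A -> A.
Hypotheses (fL : linear f) (gL : linear g).

Lemma bilinear_contr : bilinear_map (fun x y => f x * g y).
Proof.
split=> x k y z; first by rewrite fL mulrDl -scalerAl.
by rewrite gL mulrDr -scalerAr.
Qed.

Lemma contr_sum I (r : seq I) (P : pred I) (u w : I -> A) :
  contr f g (\sum_(i <- r | P i) tp (u i) (w i)) =
    \sum_(i <- r | P i) f (u i) * g (w i).
Proof. exact: tlift_sum bilinear_contr. Qed.
End Contr.

Lemma scalar_alg_linear (phi : A -> K) :
  scalar phi -> linear (fun x => (phi x)%:A : A).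
Proof. by move=> pL a x y; rewrite pL scalerDl scalerA. Qed.

Lemma id_linear : linear (@id A). Proof. by []. Qed.

End TensorAlgebra.

Section Comatrix.
Variables (K : fieldType) (H : hopfAlg K).
Local Notation b := (vbas : 'I_(dim H) -> H).
Implicit Types h x y : H.

Definition comulT h : talg H := comul h.

Lemma comulT_linear : linear comulT. Proof. exact: comul_linear. Qed.
Lemma comulTM x y : comulT (x * y) =
  comulT x * comulT y. Proof. exact: comulM. Qed.
Lemma comulT1 : comulT 1 = 1. Proof. exact: comul1. Qed.
Lemma comulTZ a x : comulT (a *: x) =
  a *: comulT x. Proof. exact: (linear_funZ _ _ comulT_linear). Qed.
Lemma comulT_sum I (r : seq I) (P : pred I) F :
  comulT (\sum_(i <- r | P i) F i) = \sum_(i <- r | P i) comulT (F i).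
Proof. exact: (linear_fun_sum _ _ _ comulT_linear). Qed.

(* Sweedler sums are computed with these matrices over [H]: the coproduct of an
   entry is a matrix product, and applying [S] to the entries inverts the
   matrix. *)
Definition comatl (i j : 'I_(dim H)) : H := \sum_k (comul (b i) : 'M_(_, _)) k
  j *: b k.
Definition comatr (j i : 'I_(dim H)) : H := \sum_k (comul (b i) : 'M_(_, _)) j
  k *: b k.

Lemma comulT_vbasl i : comulT (b i) = \sum_j tp (comatl i j) (b j).
Proof.
rewrite /comulT [comul _]tens_sum exchange_big; apply: eq_bigr => j _ /=.
by rewrite tp_suml; apply: eq_bigr => k _; rewrite tpZl.
Qed.

Lemma comulT_vbasr i : comulT (b i) = \sum_j tp (b j) (comatr j i).
Proof.
rewrite /comulT [comul _]tens_sum; apply: eq_bigr => j _ /=.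
by rewrite tp_sumr; apply: eq_bigr => k _; rewrite -tpZ tpZl.
Qed.

Lemma sum_vcoef_vbas (T : lmodType K) (u : 'I_(dim H) -> T) k :
  \sum_j vcoef k (b j) *: u j = u k.
Proof.
rewrite (bigD1 k) //= vcoef_vbas eqxx scale1r big1 ?addr0 // => j /negbTE jk.
by rewrite vcoef_vbas jk scale0r.
Qed.

Lemma tensor_coef_inj (T : vectType K) (u w : 'I_(dim H) -> T) :
  \sum_j u j ⊗ b j = \sum_j w j ⊗ b j -> u =1 w.
Proof.
move=> E k; have B : bilinear_map (fun (x : T) (y : H) => vcoef k y *: x).
  split=> z a x y; first by rewrite scalerDr !scalerA mulrC.
  by rewrite vcoef_linear scalerDl scalerA.
have := congr1 (tlift (fun (x : T) (y : H) => vcoef k y *: x)) E;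
  rewrite !tlift_sum //.
by rewrite !sum_vcoef_vbas.
Qed.

Lemma tensor_coef_injl (T : vectType K) (u w : 'I_(dim H) -> T) :
  \sum_j b j ⊗ u j = \sum_j b j ⊗ w j -> u =1 w.
Proof.
move=> E k; have B : bilinear_map (fun (y : H) (x : T) => vcoef k y *: x).
  split=> z a x y; first by rewrite vcoef_linear scalerDl scalerA.
  by rewrite scalerDr !scalerA mulrC.
have := congr1 (tlift (fun (y : H) (x : T) => vcoef k y *: x)) E;
  rewrite !tlift_sum //.
by rewrite !sum_vcoef_vbas.
Qed.

Lemma tassoc_pure (x y z : H) : tassoc ((x ⊗ y) ⊗ z) = x ⊗ (y ⊗ z).
Proof.
have B (z' : H) : bilinear_map (fun u w : H => u ⊗ (w ⊗ z')).
  by split=> p k q r; rewrite ?tpure_linearl ?tpure_linearr ?tpure_linearl.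
rewrite /tassoc tliftE; first by rewrite tliftE //; have [] := B z.
  by move=> w; exact: tlift_is_linear.
move=> t; apply: tlift_param => u w k p q.
by rewrite !tpure_linearr.
Qed.

Definition tassoc_inv (t : tens H (tens H H)) : tens (tens H H) H :=
  tlift (fun x s => tlift (fun y z => (x ⊗ y) ⊗ z) s) t.

Lemma tassoc_inv_pure (x y z : H) : tassoc_inv (x ⊗ (y ⊗ z)) = (x ⊗ y) ⊗ z.
Proof.
have B (x' : H) : bilinear_map (fun y z : H => (x' ⊗ y) ⊗ z).
  by split=> p k q r; rewrite ?tpure_linearr ?tpure_linearl ?tpure_linearr.
rewrite /tassoc_inv tliftE; first by rewrite tliftE //; have [] := B x.
  move=> t; apply: tlift_param => u w k p q.
  by rewrite !tpure_linearl.
by move=> w; exact: tlift_is_linear.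
Qed.

Lemma tassocK : cancel (@tassoc K H H H) tassoc_inv.
Proof.
apply: tens_ext => [|//|t z].
  by move=> k x y; rewrite /tassoc /tassoc_inv !tlift_is_linear.
move: t; apply: tens_ext => [||x y].
- by move=> k p q; rewrite /tassoc /tassoc_inv tpure_linearl !tlift_is_linear.
- by move=> k p q; rewrite tpure_linearl.
by rewrite tassoc_pure tassoc_inv_pure.
Qed.

Lemma tassoc_sum I (r : seq I) (P : pred I) F :
  tassoc (\sum_(i <- r | P i) F i) =
    \sum_(i <- r | P i) tassoc (F i) :> tens H (tens H H).
Proof. exact: (linear_fun_sum _ _ _ (tlift_is_linear _)). Qed.

Lemma tassoc_pure_sum I (r : seq I) (P : pred I) (u w : I -> H) (z : H) :
  tassoc ((\sum_(i <- r | P i) u i ⊗ w i) ⊗ z) =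
    \sum_(i <- r | P i) u i ⊗ (w i ⊗ z).
Proof. by rewrite tpure_suml tassoc_sum; apply: eq_bigr => i _;
  rewrite tassoc_pure. Qed.

Lemma coassoc_sum h (I : finType) (u w : I -> H) :
  comulT h = \sum_i tp (u i) (w i) ->
  \sum_i tassoc (comul (u i) ⊗ w i) = \sum_i u i ⊗ comul (w i).
Proof.
move=> E; have := comulA h; rewrite -[comul h]/(comulT h) E.
rewrite !(linear_fun_sum _ _ _ (tmap_is_linear _ _)) tassoc_sum.
have idL : linear (@id H) by [].
rewrite (eq_bigr (fun i => tassoc (comul (u i) ⊗ w i))) => [->|i _]; last first.
  by rewrite /tp tmapE //; exact: comul_linear.
by apply: eq_bigr => i _; rewrite /tp tmapE //; exact: comul_linear.
Qed.

(** Coassociativity for [b i], compared at each basis element of the last tensor factor. *)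
Lemma comulT_comatl i j : comulT (comatl i j) =
  \sum_k tp (comatl i k) (comatl k j).
Proof.
move: j; apply: (@tensor_coef_inj (tens H H)).
apply: (can_inj tassocK); rewrite !tassoc_sum (coassoc_sum (comulT_vbasl i)).
under [RHS]eq_bigr do rewrite tassoc_pure_sum.
rewrite exchange_big; apply: eq_bigr => k _ /=.
by rewrite -tpure_sumr -[comul _]/(comulT _) comulT_vbasl.
Qed.

Lemma comulT_comatr i j : comulT (comatr j i) =
  \sum_k tp (comatr j k) (comatr k i).
Proof.
move: j; apply: (@tensor_coef_injl (tens H H)).
rewrite -(coassoc_sum (comulT_vbasr i)).
under [RHS]eq_bigr do rewrite tpure_sumr.
transitivity (\sum_k \sum_j b j ⊗ (comatr j k ⊗ comatr k i));
  last by rewrite exchange_big.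
apply: eq_bigr => k _; rewrite -[comul _]/(comulT _) comulT_vbasr.
exact: tassoc_pure_sum.
Qed.

Lemma counitl_sum h (I : finType) (u w : I -> H) :
  comulT h = \sum_i tp (u i) (w i) ->
  \sum_i counit (u i) *: w i = h.
Proof.
move=> E; rewrite -[RHS]counitl -[comul h]/(comulT h) E tlift_sum //;
  split=> z a x y.
  by rewrite counit_linear scalerDl scalerA.
by rewrite scalerDr !scalerA mulrC.
Qed.

Lemma counitr_sum h (I : finType) (u w : I -> H) :
  comulT h = \sum_i tp (u i) (w i) ->
  \sum_i counit (w i) *: u i = h.
Proof.
move=> E; rewrite -[RHS]counitr -[comul h]/(comulT h) E tlift_sum //;
  split=> z a x y.
  by rewrite scalerDr !scalerA mulrC.
by rewrite counit_linear scalerDl scalerA.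
Qed.

Lemma antipodel_sum h (I : finType) (u w : I -> H) :
  comulT h = \sum_i tp (u i) (w i) ->
  \sum_i antipode (u i) * w i = (counit h)%:A.
Proof.
move=> E; rewrite -antipodel -[comul h]/(comulT h) E tlift_sum //;
  split=> z a x y.
  by rewrite antipode_linear mulrDl -scalerAl.
by rewrite mulrDr -scalerAr.
Qed.

Lemma antipoder_sum h (I : finType) (u w : I -> H) :
  comulT h = \sum_i tp (u i) (w i) ->
  \sum_i u i * antipode (w i) = (counit h)%:A.
Proof.
move=> E; rewrite -antipoder -[comul h]/(comulT h) E tlift_sum //;
  split=> z a x y.
  by rewrite mulrDl -scalerAl.
by rewrite antipode_linear mulrDr -scalerAr.
Qed.

Lemma vcoef_lincomb (a : 'I_(dim H) -> K) j : vcoef j (\sum_k a k *: b k) = a j.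
Proof.
have cL : linear (vcoef j : H -> K^o) by exact: vcoef_linear.
rewrite [LHS](linear_fun_sum _ _ _ cL) -[RHS](sum_vcoef_vbas (a : _ -> K^o)).
by apply: eq_bigr => k _; rewrite [LHS](linear_funZ _ _ cL) [LHS]mulrC.
Qed.

Lemma counit_comatl i j : counit (comatl i j) = (i == j)%:R.
Proof.
have := congr1 (vcoef j) (counitl_sum (comulT_vbasl i));
  rewrite vcoef_vbas => <-.
by rewrite vcoef_lincomb.
Qed.

Lemma counit_comatr i j : counit (comatr j i) = (i == j)%:R.
Proof.
have := congr1 (vcoef j) (counitr_sum (comulT_vbasr i));
  rewrite vcoef_vbas => <-.
by rewrite vcoef_lincomb.
Qed.

Lemma vbas_comatl i : b i = \sum_j counit (b j) *: comatl i j.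
Proof. by rewrite (counitr_sum (comulT_vbasl i)). Qed.

(** The entries [comatl i j] span H by the counit axiom, so linear identities may be checked on
    them, where the coproduct is a matrix product. *)
Lemma comatl_ext (X : lmodType K) (f g : H -> X) : linear f -> linear g ->
  (forall i j, f (comatl i j) = g (comatl i j)) -> f =1 g.
Proof.
move=> fL gL fg h; rewrite [h]vbas_sum !(linear_fun_sum _ _ _ fL)
  !(linear_fun_sum _ _ _ gL).
apply: eq_bigr => i _; rewrite (linear_funZ _ _ fL) (linear_funZ _ _ gL);
  congr (_ *: _).
rewrite vbas_comatl (linear_fun_sum _ _ _ fL) (linear_fun_sum _ _ _ gL);
  apply: eq_bigr => j _.
by rewrite (linear_funZ _ _ fL) (linear_funZ _ _ gL) fg.
Qed.

Local Notation S := (@antipode K H).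

Lemma antipodeL : linear S. Proof. exact: antipode_linear. Qed.
Lemma antipode_sum I (r : seq I) (P : pred I) F :
  S (\sum_(i <- r | P i) F i) = \sum_(i <- r | P i) S (F i).
Proof. exact: (linear_fun_sum _ _ _ antipodeL). Qed.
Lemma antipodeZ a x : S (a *: x) =
  a *: S x. Proof. exact: (linear_funZ _ _ antipodeL). Qed.

Lemma natA (B : bool) : (B%:R : K)%:A = B%:R :> H.
Proof. by case: B; rewrite ?scale1r ?scale0r. Qed.

Lemma antipode_comatl i j : \sum_k S (comatl i k) * comatl k j = (i == j)%:R.
Proof. by rewrite (antipodel_sum (comulT_comatl i j)) counit_comatl natA. Qed.
Lemma comatl_antipode i j : \sum_k comatl i k * S (comatl k j) = (i == j)%:R.
Proof. by rewrite (antipoder_sum (comulT_comatl i j)) counit_comatl natA. Qed.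
Lemma antipode_comatr i j : \sum_k S (comatr i k) * comatr k j = (i == j)%:R.
Proof. by rewrite (antipodel_sum (comulT_comatr j i)) counit_comatr natA
  eq_sym. Qed.
Lemma comatr_antipode i j : \sum_k comatr i k * S (comatr k j) = (i == j)%:R.
Proof. by rewrite (antipoder_sum (comulT_comatr j i)) counit_comatr natA
  eq_sym. Qed.

Lemma antipode1 : S 1 = 1.
Proof.
have E : comulT 1 = \sum_(i < 1) tp (1 : H) 1 by rewrite big_ord1 comulT1.
by have := antipodel_sum E; rewrite big_ord1 mulr1 counit1 scale1r.
Qed.

Lemma counit_sum I (r : seq I) (P : pred I) (F : I -> H) :
  counit (\sum_(i <- r | P i) F i) = \sum_(i <- r | P i) counit (F i).
Proof. exact: (@linear_fun_sum K H K^o _ _ _ _ _ (@counit_linear K H)). Qed.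

Lemma counitZ a (x : H) : counit (a *: x) = a * counit x.
Proof. exact: (@linear_funZ K H K^o _ _ _ (@counit_linear K H)). Qed.

Lemma counitS h : counit (S h) = counit h.
Proof.
move: h; apply: (@comatl_ext K^o); [by move=> a x y;
  rewrite antipodeL counit_linear | exact: counit_linear|].
move=> i j; have := congr1 (@counit K H) (antipode_comatl i j).
rewrite counit_sum (bigD1 j) //= counitM counit_comatl eqxx mulr1 big1 ?addr0
  => [->|k kj].
  by rewrite counit_comatl -natA counitZ counit1 mulr1.
by rewrite counitM counit_comatl (negbTE kj) mulr0.
Qed.

Lemma sum_deltal (R : pzRingType) (F : 'I_(dim H) -> R) i :
  \sum_k (i == k)%:R * F k = F i.
Proof.
rewrite (bigD1 i) //= eqxx mul1r big1 ?addr0 // => k ki.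
by rewrite eq_sym (negbTE ki) mul0r.
Qed.

Lemma sum_deltar (R : pzRingType) (F : 'I_(dim H) -> R) i :
  \sum_k F k * (k == i)%:R = F i.
Proof.
rewrite (bigD1 i) //= eqxx mulr1 big1 ?addr0 // => k ki.
by rewrite (negbTE ki) mulr0.
Qed.

Lemma antipode_comatl_mul i j k l :
  \sum_p \sum_r S (comatl i p * comatl k r) * (comatl p j * comatl r l) =
    (i == j)%:R * (k == l)%:R.
Proof.
have E : comulT (comatl i j * comatl k l) = \sum_pr
    tp (comatl i pr.1 * comatl k pr.2) (comatl pr.1 j * comatl pr.2 l).
  rewrite comulTM !comulT_comatl mulr_suml -(pair_bigA _ (fun p r =>
    tp (comatl i p * comatl k r) (comatl p j * comatl r l)));
      apply: eq_bigr => p _ /=.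
  by rewrite mulr_sumr; apply: eq_bigr => r _; rewrite tpM.
have := antipodel_sum E; rewrite -(pair_bigA _ (fun p r =>
  S (comatl i p * comatl k r) * (comatl p j * comatl r l))) /= => ->.
by rewrite counitM !counit_comatl -!natrM !mulnb natA.
Qed.

Lemma antipodeM x y : S (x * y) = S y * S x.
Proof.
move: x; apply: comatl_ext => [a u v|a u v|i j].
- by rewrite mulrDl -scalerAl antipodeL.
- by rewrite antipodeL mulrDr -scalerAr.
move: y; apply: comatl_ext => [a u v|a u v|k l].
- by rewrite mulrDr -scalerAr antipodeL.
- by rewrite antipodeL mulrDl -scalerAl.
pose Z := \sum_q \sum_s (\sum_p \sum_r S (comatl i p * comatl k r) * (comatl p
  q * comatl r s))
   * (S (comatl s l) * S (comatl q j)).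
transitivity Z; rewrite /Z; last first.
  rewrite (eq_bigr (fun q => (i == q)%:R * (S (comatl k l) * S (comatl q j)))).
    by rewrite sum_deltal.
  move=> q _; rewrite -[in RHS](sum_deltal (fun s => S (comatl s l))) mulr_suml
    mulr_sumr.
  by apply: eq_bigr => s _; rewrite antipode_comatl_mul !mulrA.
transitivity (\sum_q \sum_p S (comatl i p * comatl k l) * (comatl p q * S
  (comatl q j))).
  rewrite exchange_big (eq_bigr (fun p => S (comatl i p * comatl k l) * (p ==
    j)%:R)).
    by rewrite (sum_deltar (fun p => S (comatl i p * comatl k l))).
  by move=> p _; rewrite -mulr_sumr comatl_antipode.
apply: eq_bigr => q _.
under [RHS]eq_bigr do rewrite mulr_suml.
rewrite exchange_big; apply: eq_bigr => p _ /=.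
under [RHS]eq_bigr do rewrite mulr_suml.
rewrite exchange_big /=.
rewrite (eq_bigr (fun r => (S (comatl i p * comatl k r) * (comatl p q * (r ==
  l)%:R)) * S (comatl q j))).
  by under eq_bigr do rewrite !mulrA; rewrite -mulr_suml sum_deltar mulrA.
move=> r _; rewrite -comatl_antipode !mulr_sumr !mulr_suml;
  apply: eq_bigr => s _.
by rewrite !mulrA.
Qed.

(** [X] is a left and [W] a right inverse of the matrix [Y] over the tensor algebra, hence they
    coincide. *)
Lemma comulT_antipode_comatl i j :
  comulT (S (comatl i j)) = \sum_k tp (S (comatl k j)) (S (comatl i k)).
Proof.
pose X := \matrix_(i, j) comulT (S (comatl i j)).
pose Y := \matrix_(i, j) comulT (comatl i j).
pose W := \matrix_(i, j) \sum_k tp (S (comatl k j)) (S (comatl i k)).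
have delta (i' j' : 'I_(dim H)) : comulT ((i' == j')%:R) =
  (1%:M : 'M[talg H]_(dim H)) i' j'.
  by rewrite mxE; case: eqP => _;
    [exact: comulT1 | exact: (linear_fun0 comulT_linear)].
have XY : X *m Y = 1%:M.
  apply/matrixP => i' j'; rewrite -delta -antipode_comatl mxE comulT_sum;
    apply: eq_bigr => k _.
  by rewrite !mxE comulTM.
have YW : Y *m W = 1%:M.
  apply/matrixP => i' j'; rewrite !mxE.
  transitivity (\sum_k tp (comatl i' k * S (comatl k j')) 1).
    under eq_bigr do rewrite !mxE comulT_comatl mulr_suml.
    rewrite exchange_big; apply: eq_bigr => p _ /=.
    under eq_bigr do rewrite mulr_sumr.
    rewrite exchange_big /=.
    rewrite (eq_bigr (fun k => tp (comatl i' p * S (comatl k j')) (p == k)%:R)).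
      rewrite (bigD1 p) //= eqxx big1 ?addr0 // => k kp.
      by rewrite eq_sym (negbTE kp) [LHS]tpure0r.
    move=> k _; rewrite -comatl_antipode tp_sumr; apply: eq_bigr => q _.
    by rewrite tpM.
  by rewrite -tp_suml comatl_antipode; case: eqP => _; [|exact: tpure0l].
have /matrixP/(_ i j) : X = W by rewrite -[X]mulmx1 -YW mulmxA XY mul1mx.
by rewrite !mxE.
Qed.

End Comatrix.

(** * Integrals *)

Lemma talg_mulZl (K : fieldType) (A : falgType K) a (s t : talg A) :
  (a *: s) * t = a *: (s * t).
Proof. exact: (linear_funZ _ _ (tmul_linearl t)). Qed.

Lemma talg_mulZr (K : fieldType) (A : falgType K) a (s t : talg A) :
  s * (a *: t) = a *: (s * t).
Proof. exact: (linear_funZ _ _ (tmul_linearr s)). Qed.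

Lemma tp_linearl (K : fieldType) (A : falgType K) (y : A) :
  linear (fun x => tp x y).
Proof. exact: tpure_linearl. Qed.

Lemma tp_linearr (K : fieldType) (A : falgType K) (x : A) : linear (tp x).
Proof. exact: tpure_linearr. Qed.

Lemma inj_surj (K : fieldType) (V : vectType K) (f : V -> V) : linear f ->
  (forall x, f x = 0 -> x = 0) -> forall y, exists x, f x = y.
Proof.
move=> fL f0 y; pose g : {linear V ->
  V} := HB.pack f (GRing.isLinear.Build _ _ _ _ _ fL).
have k0 : lker (linfun g) == 0%VS.
  apply/eqP/vspaceP => x; rewrite memv0 memv_ker lfunE /=.
  by apply/eqP/eqP => [/f0 //|->]; exact: (linear_fun0 fL).
have : y \in limg (linfun g).
  have /eqP -> : limg (linfun g) == fullv.
    by rewrite eqEdim subvf -[X in (X <= _)%N](limg_ker_dim (linfun g) fullv)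
      (eqP k0) capv0 dimv0 add0n leqnn.
  exact: memvf.
by case/memv_imgP => x _ ->; exists x; rewrite lfunE.
Qed.

Section HopfIntegral.
Variables (K : fieldType) (K0 : [pchar K] =i pred0).
Variables (H : hopfAlg K) (H_ss : semisimple H).
Local Notation b := (vbas : 'I_(dim H) -> H).
Local Notation S := (@antipode K H).
Local Notation eps := (@counit K H).
Implicit Types h x y a : H.

Lemma counitB x y : eps (x - y) = eps x - eps y.
Proof. by rewrite addrC -scaleN1r counit_linear mulN1r addrC. Qed.

(** The augmentation ideal [ker eps] has a central unit [e], and [L = 1 - e]. *)
Lemma integral_exists : exists L : H,
  [/\ eps L = 1, forall h, h * L = eps h *: L & central L].
Proof.
have [U UE] : exists U : {vspace H}, forall x, (x \in U) = (eps x == 0).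
  exact: (@ker_vspace K H K^o _ (@counit_linear K H)).
have [a u|a u|e [eU eE ce]] := @ideal_idem _ _ H_ss U.
- by rewrite !UE counitM => /eqP ->; rewrite mulr0.
- by rewrite !UE counitM => /eqP ->; rewrite mul0r.
exists (1 - e); split.
- by rewrite counitB counit1; move: eU; rewrite UE => /eqP ->; rewrite subr0.
- move=> h; apply/eqP; rewrite -subr_eq0 -[eps h *: _]mul1r -scalerAr scalerAl
  -mulrBl.
  have hU : h - eps h *: 1 \in U
    by rewrite UE counitB counitZ counit1 mulr1 subrr.
  by rewrite mulrBr mulr1 eE // subrr.
by move=> x; rewrite mulrBl mulrBr mul1r mulr1 ce.
Qed.

Variable (L : H).
Hypotheses (eL : eps L = 1) (hL : forall h, h * L = eps h *: L)
  (cL : central L).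

Lemma integral_idem : L * L = L. Proof. by rewrite hL eL scale1r. Qed.

Lemma regtrace_integral : regtrace L = 1.
Proof.
rewrite /regtrace (@ltrace_dual _ _ 'I_1 (fun _ => eps) (fun _ => L)).
- by rewrite big_ord1.
- by move=> _; exact: counit_linear.
by move=> x; rewrite big_ord1 cL hL.
Qed.

(** The factor [L1] in the coproduct of [L] that stands beside the basis element [b k] as [L2]. *)
Definition integral_comp k : H := \sum_i vcoef i L *: comatl i k.

Lemma comulT_integral : comulT L = \sum_k tp (integral_comp k) (b k).
Proof.
rewrite {1}[L]vbas_sum comulT_sum.
under eq_bigr do rewrite comulTZ comulT_vbasl scaler_sumr.
rewrite exchange_big; apply: eq_bigr => k _; rewrite tp_suml.
by apply: eq_bigr => i _; rewrite tpZl.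
Qed.

(* [L1 ⊗ a L2 = S(a) L1 ⊗ L2] *)
Lemma integral_shiftl a : \sum_k tp (integral_comp k) (a * b k) =
  \sum_k tp (S a * integral_comp k) (b k).
Proof.
suff E : tp 1 a * comulT L = tp (S a) 1 * comulT L.
  move: E; rewrite comulT_integral !mulr_sumr => E.
  transitivity (\sum_k tp 1 a * tp (integral_comp k) (b k)); last rewrite E.
    by apply: eq_bigr => k _; rewrite tpM mul1r.
  by apply: eq_bigr => k _; rewrite tpM mul1r.
move: a; apply: comatl_ext => [k x y|k x y|i j].
- by rewrite tp_linearr mulrDl talg_mulZl.
- by rewrite antipodeL tp_linearl mulrDl talg_mulZl.
(* Write [1 ⊗ a] as [(S(a1) ⊗ 1) Δ(a2)]; then [Δ(a2) Δ(L) = eps(a2) Δ(L)]. *)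
transitivity (\sum_k \sum_l tp (S (comatl i k)) 1 * tp (comatl k l) (comatl l
  j) * comulT L).
  rewrite exchange_big -[tp 1 _ in LHS](_ : \sum_l tp ((i == l)%:R) (comatl l
    j) = _).
    rewrite mulr_suml; apply: eq_bigr => l _;
      rewrite -antipode_comatl tp_suml mulr_suml.
    by apply: eq_bigr => k _; rewrite tpM mul1r.
  rewrite (bigD1 i) //= eqxx big1 ?addr0 // => l li.
  by rewrite eq_sym (negbTE li); exact: tpure0l.
transitivity (\sum_k tp (S (comatl i k)) 1 * (k == j)%:R * comulT L);
  last first.
  by rewrite -mulr_suml sum_deltar.
apply: eq_bigr => k _.
rewrite -[RHS]mulrA (_ : _ * comulT L =
  \sum_l tp (comatl k l) (comatl l j) * comulT L).
  by rewrite mulr_sumr; apply: eq_bigr => l _; rewrite mulrA.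
rewrite -mulr_suml -comulT_comatl -comulTM hL comulTZ counit_comatl.
by case: eqP => _; rewrite ?mul1r ?scale1r // mul0r scale0r.
Qed.

(* [L1 a ⊗ L2 = L1 ⊗ L2 S(a)] *)
Lemma integral_shiftr a : \sum_k tp (integral_comp k * a) (b k) =
  \sum_k tp (integral_comp k) (b k * S a).
Proof.
suff E : comulT L * tp a 1 = comulT L * tp 1 (S a).
  move: E; rewrite comulT_integral !mulr_suml => E.
  transitivity (\sum_k tp (integral_comp k) (b k) * tp a 1); last rewrite E.
    by apply: eq_bigr => k _; rewrite tpM mulr1.
  by apply: eq_bigr => k _; rewrite tpM mulr1.
move: a; apply: comatl_ext => [k x y|k x y|i j].
- by rewrite tp_linearl mulrDr talg_mulZr.
- by rewrite antipodeL tp_linearr mulrDr talg_mulZr.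
transitivity (\sum_l \sum_k comulT L * tp (comatl i k) (comatl k l) * tp 1 (S
  (comatl l j))).
  rewrite exchange_big -[tp _ 1 in LHS](_ : \sum_k tp (comatl i k) ((k ==
    j)%:R) = _).
    rewrite mulr_sumr; apply: eq_bigr => k _;
      rewrite -comatl_antipode tp_sumr mulr_sumr.
    by apply: eq_bigr => l _; rewrite -mulrA tpM mulr1.
  rewrite (bigD1 j) //= eqxx big1 ?addr0 // => l lj.
  by rewrite (negbTE lj); exact: tpure0r.
transitivity (\sum_l comulT L * ((i == l)%:R * tp 1 (S (comatl l j))));
  last first.
  by rewrite -mulr_sumr sum_deltal.
apply: eq_bigr => l _; rewrite -mulr_suml -mulr_sumr -comulT_comatl -comulTM cL
  hL comulTZ counit_comatl.
by case: eqP => _; rewrite ?mul1r ?scale1r // mul0r mulr0 scale0r mul0r.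
Qed.

Lemma scal_mul (c : K) (x : H) : x * c%:A = c *: x.
Proof. by rewrite -scalerAr mulr1. Qed.

Lemma scal_mull (c : K) (x : H) : c%:A * x = c *: x.
Proof. by rewrite -scalerAl mul1r. Qed.

(* The central idempotent generating the kernel of [S] is the average
   [L1 e S(L2)], which vanishes because [L1 e ⊗ L2 = L1 ⊗ L2 S(e)]. *)
Lemma antipode_eq0 x : S x = 0 -> x = 0.
Proof.
move=> Sx; have [U UE] : exists U : {vspace H}, forall x, (x \in U) =
  (S x == 0).
  exact: (ker_vspace (@antipodeL K H)).
have [a u|a u|e [eU eE ce]] := @ideal_idem _ _ H_ss U.
- by rewrite !UE antipodeM => /eqP ->; rewrite mul0r.
- by rewrite !UE antipodeM => /eqP ->; rewrite mulr0.
have Se : S e = 0 by apply/eqP; rewrite -UE.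
have : contr id S (\sum_k tp (integral_comp k * e) (b k)) = 0.
  rewrite integral_shiftr Se (eq_bigr (fun=> 0));
    first by rewrite big1_eq [LHS](linear_fun0 (tlift_is_linear _)).
  by move=> k _; rewrite mulr0; exact: tpure0r.
rewrite (contr_sum (@id_linear _ _) (@antipodeL K H)).
rewrite (eq_bigr (fun k => e * (integral_comp k * S (b k)))) => [|k _];
  last by rewrite -ce mulrA.
rewrite -mulr_sumr (antipoder_sum comulT_integral) eL scale1r mulr1 => e0.
by rewrite -(eE x) ?UE ?Sx // e0 mulr0.
Qed.

Lemma antipode_inj : injective S.
Proof.
move=> x y /eqP; rewrite -subr_eq0 => xy; apply/eqP; rewrite -subr_eq0;
  apply/eqP/antipode_eq0.
by rewrite addrC -scaleN1r antipodeL scaleN1r addrC; apply/eqP.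
Qed.

Lemma antipode_surj y : exists x, S x = y.
Proof. exact: (inj_surj (@antipodeL K H) antipode_eq0). Qed.

Local Notation sg := (fun x : H => S (S x)).

Lemma antipode2L : linear sg. Proof. by move=> a x y; rewrite !antipodeL. Qed.

(** The condition is [h1 phi(h2) = phi(h) 1] for [h] in the basis, so [phi] is a left integral of
    the dual algebra. *)
Definition left_integral (phi : H -> K) :=
  scalar phi /\ forall i, \sum_j phi (b j) *: comatl i j = (phi (b i))%:A.

Lemma left_integral_sum phi : left_integral phi ->
  forall h (I : finType) (u w : I -> H), comulT h = \sum_i tp (u i) (w i) ->
  \sum_i phi (w i) *: u i = (phi h)%:A.
Proof.
move=> [pL pI] h I u w E.
have pA := scalar_alg_linear (A := H) pL.
have C (J : finType) (u' w' : J -> H) :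
    contr id (fun y => (phi y)%:A) (\sum_i tp (u' i) (w' i)) =
      \sum_i phi (w' i) *: u' i.
  by rewrite (contr_sum (@id_linear _ _) pA); apply: eq_bigr => i _;
    rewrite scal_mul.
rewrite -C -E; move: h {E}; apply: vbas_ext => [a x y|//|i].
  by rewrite comulT_linear; exact: tlift_is_linear.
by rewrite comulT_vbasl C pI.
Qed.

(** Contract [L1 ⊗ a L2 = S(a) L1 ⊗ L2] with [phi] on the second factor. With [phi L = 1] this
    recovers the antipode from an integral. *)
Lemma left_integral_antipode phi a : left_integral phi ->
  \sum_k phi (a * b k) *: integral_comp k = phi L *: S a.
Proof.
move=> pI; have [pL _] := pI; have pA := scalar_alg_linear (A := H) pL.
have := congr1 (contr id (fun y => (phi y)%:A)) (integral_shiftl a).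
rewrite !(contr_sum (@id_linear _ _) pA).
under eq_bigr do rewrite scal_mul.
move=> ->; rewrite -[RHS]scal_mul -(left_integral_sum pI comulT_integral)
  mulr_sumr.
by apply: eq_bigr => k _; rewrite scal_mul scalerAr.
Qed.

Definition twisted_trace h := ltrace (fun x => h * sg x).

Lemma twisted_trace_scalar : scalar twisted_trace.
Proof.
move=> a x y; rewrite /twisted_trace -ltraceZ -ltraceD; apply: eq_ltrace => z.
by rewrite mulrDl -scalerAl.
Qed.

Lemma twisted_trace_integral : twisted_trace L = 1.
Proof.
rewrite -regtrace_integral; apply: eq_ltrace => x.
by rewrite !cL !hL !counitS.
Qed.

Lemma comulT_antipode h (I : finType) (u w : I -> H) :
  comulT h = \sum_i tp (u i) (w i) ->
  comulT (S h) = \sum_i tp (S (w i)) (S (u i)).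
Proof.
pose F (x y : H) : talg H := tp (S y) (S x).
have FB : bilinear_map F.
  by split=> z k x y; rewrite /F antipodeL ?tp_linearr ?tp_linearl.
move=> E; rewrite -(tlift_sum _ _ _ _ FB) -[\sum_i _]E.
move: h {E}; apply: comatl_ext => [k x y|k x y|i j].
- by rewrite antipodeL comulT_linear.
- by rewrite comulT_linear; exact: tlift_is_linear.
by rewrite comulT_antipode_comatl comulT_comatl (tlift_sum _ _ _ _ FB).
Qed.

Lemma comulT_antipode2 i : comulT (sg (b i)) =
  \sum_j tp (sg (comatl i j)) (sg (b j)).
Proof.
have cD_SS p q : comulT (sg (comatl p q)) =
  \sum_j tp (sg (comatl p j)) (sg (comatl j q)).
  exact: (comulT_antipode (comulT_antipode_comatl p q)).
rewrite [b i]vbas_comatl !antipode_sum comulT_sum.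
under eq_bigr do rewrite !antipodeZ comulTZ cD_SS scaler_sumr.
rewrite exchange_big; apply: eq_bigr => j _ /=.
rewrite [b j in RHS]vbas_comatl !antipode_sum tp_sumr; apply: eq_bigr => k _.
by rewrite !antipodeZ -tpZ tpZl.
Qed.

(** Taking the coproduct of [b p * sg (b i)] produces factors [sg (comatl i j)]. They are cancelled
    by [I2], which is [S] applied to an antipode identity; [S] reverses products, and this is why
    the trace has to be twisted by S^2. *)
Lemma twisted_trace_left_integral : left_integral twisted_trace.
Proof.
split=> [|p]; first exact: twisted_trace_scalar.
pose P j i := vcoef j (b p * sg (b i)).
pose q k j : H := \sum_r vcoef k (b r * sg (b j)) *: comatl p r.
have I1 i k : \sum_j q k j * sg (comatl i j) = \sum_j P j i *: comatl j k.
  move: k; apply: (@tensor_coef_inj _ H H).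
  transitivity (comulT (b p * sg (b i))); last first.
    rewrite [X in comulT X]vbas_sum comulT_sum.
    under eq_bigr do rewrite comulTZ comulT_vbasl scaler_sumr.
    rewrite exchange_big; apply: eq_bigr => k _; rewrite tpure_suml.
    by apply: eq_bigr => j _; rewrite tpureZl.
  rewrite comulTM comulT_vbasl comulT_antipode2 mulr_suml.
  transitivity (\sum_r \sum_j \sum_k
      (vcoef k (b r * sg (b j)) *: (comatl p r * sg (comatl i j))) ⊗ b k).
    rewrite exchange_big.
    under [RHS]eq_bigr do rewrite exchange_big.
    rewrite exchange_big; apply: eq_bigr => k _ /=;
      rewrite -[LHS]/(tp _ _) tp_suml.
    apply: eq_bigr => j _ /=; rewrite mulr_suml tp_suml.
    by apply: eq_bigr => r _; rewrite -scalerAl.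
  apply: eq_bigr => r _; rewrite mulr_sumr; apply: eq_bigr => j _.
  rewrite tpM [X in tp _ X]vbas_sum tp_sumr; apply: eq_bigr => k _.
  by rewrite -tpZ.
have I2 j l : \sum_i sg (comatl i j) * S (comatl l i) = (l == j)%:R.
  under eq_bigr do rewrite -antipodeM.
  rewrite -antipode_sum comatl_antipode; case: eqP => _;
    [exact: antipode1 | exact: (linear_fun0 (@antipodeL K H))].
have I3 k l : q k l = \sum_i \sum_j P j i *: (comatl j k * S (comatl l i)).
  rewrite -(sum_deltal (q k) l).
  transitivity (\sum_j q k j * (l == j)%:R).
    by apply: eq_bigr => j _; case: eqP => _;
      rewrite ?mul1r ?mulr1 ?mul0r ?mulr0.
  under eq_bigr do rewrite -I2 mulr_sumr.
  rewrite exchange_big; apply: eq_bigr => i _ /=.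
  under eq_bigr do rewrite mulrA.
  rewrite -mulr_suml I1 mulr_suml; apply: eq_bigr => j _.
  by rewrite -scalerAl.
transitivity (\sum_k q k k).
  rewrite exchange_big; apply: eq_bigr => r _.
  by rewrite -scaler_suml.
under eq_bigr do rewrite I3.
rewrite exchange_big /twisted_trace /ltrace scaler_suml;
  apply: eq_bigr => i _ /=.
rewrite exchange_big /=.
under eq_bigr do rewrite -scaler_sumr comatl_antipode.
rewrite (bigD1 i) //= eqxx big1 ?addr0 // => j ji.
by rewrite (negbTE ji) scaler0.
Qed.

Lemma antipode_twisted_trace a :
  S a = \sum_k twisted_trace (a * b k) *: integral_comp k.
Proof. by rewrite (left_integral_antipode a twisted_trace_left_integral)
  twisted_trace_integral scale1r. Qed.

Definition rconv (f : H -> K) (h : H) : H := tlift (fun x y : H => f x *: y)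
  (comulT h).

Lemma rconv_linear f : linear (rconv f).
Proof. by move=> a x y; rewrite /rconv comulT_linear tlift_is_linear. Qed.

Lemma rconv_sum f h (I : finType) (u w : I -> H) : scalar f ->
  comulT h = \sum_i tp (u i) (w i) -> rconv f h = \sum_i f (u i) *: w i.
Proof.
move=> fL E; rewrite /rconv E; apply: tlift_sum; split=> z a x y.
  by rewrite fL scalerDl scalerA.
by rewrite scalerDr !scalerA mulrC.
Qed.

Lemma rconv_vbas f i : scalar f -> rconv f (b i) = \sum_j f (comatl i j) *: b j.
Proof. by move=> fL; apply: rconv_sum (comulT_vbasl i). Qed.

Lemma rconv_comatl f i j : scalar f ->
  rconv f (comatl i j) = \sum_k f (comatl i k) *: comatl k j.
Proof. by move=> fL; apply: rconv_sum (comulT_comatl i j). Qed.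

Lemma twisted_trace_sum (I : Type) (r : seq I) (P : pred I) (F : I -> H) :
  twisted_trace (\sum_(i <- r | P i) F i) =
    \sum_(i <- r | P i) twisted_trace (F i).
Proof. exact: (@linear_fun_sum K H K^o _ _ _ _ _ twisted_trace_scalar). Qed.

Lemma twisted_traceZ k x : twisted_trace (k *: x) = k * twisted_trace x.
Proof. exact: (@linear_funZ K H K^o _ _ _ twisted_trace_scalar). Qed.

(** Radford's trace formula. Move one [S] around the trace and expand the other as
    [S x = m(x L2) L1], with [m] the twisted trace; the result is
    [f(L1) m(S(L2) L3) = f(L) m(1)]. *)
Lemma ltrace_rconv_antipode2 f :
  scalar f -> ltrace (fun x => rconv f (sg x)) = f L * twisted_trace 1.
Proof.
move=> fL; have RL := rconv_linear f.
transitivity (ltrace (fun x => S (rconv f (S x)))).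
  have RS : linear (rconv f \o S) by move=> a x y; rewrite /= antipodeL RL.
  exact: (ltrace_comp RS (@antipodeL K H)).
rewrite (@ltrace_dual _ _ _ (fun k x => twisted_trace (x * b k)) (fun k => S
  (rconv f (integral_comp k)))).
- transitivity (\sum_i \sum_m vcoef i L * f (comatl i m) * (\sum_k
  twisted_trace (S (comatl m k) * b k))).
    have E k : S (rconv f (integral_comp k)) * b k =
        \sum_i \sum_m (vcoef i L * f (comatl i m)) *: (S (comatl m k) * b k).
      rewrite /integral_comp (linear_fun_sum _ _ _ RL) antipode_sum mulr_suml;
        apply: eq_bigr => i _.
      rewrite (linear_funZ _ _ RL) antipodeZ rconv_comatl // antipode_sum
        scaler_sumr mulr_suml.
      by apply: eq_bigr => m _; rewrite antipodeZ scalerA -scalerAl.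
    under eq_bigr do rewrite E twisted_trace_sum.
    rewrite exchange_big; apply: eq_bigr => i _ /=.
    under eq_bigr do rewrite twisted_trace_sum.
    rewrite exchange_big; apply: eq_bigr => m _ /=.
    by rewrite mulr_sumr; apply: eq_bigr => k _; rewrite twisted_traceZ.
  have E m : \sum_k twisted_trace (S (comatl m k) * b k) =
    eps (b m) * twisted_trace 1.
    by rewrite -twisted_trace_sum (antipodel_sum (comulT_vbasl m))
      twisted_traceZ.
  under eq_bigr do under eq_bigr do rewrite E.
  move: (twisted_trace 1) => m1; rewrite (vbas_scalar L fL) mulr_suml;
    apply: eq_bigr => i _.
  rewrite [b i in RHS](vbas_comatl i) (scalar_fun_sum _ _ _ fL) mulr_sumr
    mulr_suml.
  by apply: eq_bigr => m _; rewrite (scalar_funZ _ _ fL) !mulrA (mulrAC _ (f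
    _)).
- by move=> k a x y; rewrite mulrDl -scalerAl twisted_trace_scalar.
by move=> x; rewrite [S x]antipode_twisted_trace (linear_fun_sum _ _ _ RL)
  antipode_sum; apply: eq_bigr => k _; rewrite (linear_funZ _ _ RL) antipodeZ.
Qed.

End HopfIntegral.

(** * The square of the antipode *)

Lemma ltrace_conj (K : fieldType) (V : vectType K) (f g s : V -> V) :
    linear f -> linear g -> linear s -> (forall x, s x = 0 -> x = 0) ->
  (forall x, f (s x) = s (g x)) -> ltrace f = ltrace g.
Proof.
move=> fL gL sL s0 fs; have [s' sK] := choice (inj_surj sL s0).
have sI x y : s x = s y -> x = y.
  move=> xy; apply/eqP; rewrite -subr_eq0; apply/eqP/s0.
  by rewrite addrC -scaleN1r sL scaleN1r xy addNr.
have s'L : linear s' by move=> a x y; apply: sI; rewrite sK sL !sK.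
have sgL' : linear (s \o g) by move=> a x y; rewrite /= gL sL.
transitivity (ltrace ((s \o g) \o s')).
  by apply: eq_ltrace => x /=; rewrite -fs sK.
rewrite ltrace_comp //; apply: eq_ltrace => x /=; apply: sI; exact: sK.
Qed.

(** * Grouplike elements *)

Section Grouplike.
Variables (K : fieldType) (H : hopfAlg K).

Definition grouplike (x : H) := comulT x = tp x x /\ counit x = 1.

Lemma grouplike1 : grouplike 1.
Proof. by split; [exact: comulT1 | exact: counit1]. Qed.

Lemma grouplikeM x y : grouplike x -> grouplike y -> grouplike (x * y).
Proof. by move=> [Dx ex] [Dy ey]; split;
  rewrite ?comulTM ?Dx ?Dy ?tpM // counitM ex ey mulr1. Qed.

Lemma grouplike_antipode x : grouplike x ->
  x * antipode x = 1 /\ antipode x * x = 1.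
Proof.
move=> [Dx ex]; have E : comulT x = \sum_(i < 1) tp x x by rewrite big_ord1.
have := antipoder_sum E; have := antipodel_sum E.
by rewrite !big_ord1 ex scale1r.
Qed.

(** If [x] is a combination of independent grouplikes with coefficients [a i], comparing [Δ(x)] with
    [x ⊗ x] gives [a i * a j = 0] for distinct [i], [j] and [a i ^+ 2 = a i], so [x] is one of
    them. *)
Lemma grouplike_free (s : seq H) :
  uniq s -> (forall x, x \in s -> grouplike x) -> free s.
Proof.
elim: s => [_ _|x s IHs /= /andP[xs us] sG]; first exact: nil_free.
have fs : free s by apply: IHs => // y ys; apply: sG; rewrite inE ys orbT.
rewrite free_cons fs andbT; apply/negP => xsp.
have [Dx ex] := sG x (mem_head _ _).
pose X := in_tuple s; pose a i := coord X i x.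
have xE : x = \sum_i a i *: X`_i by exact: coord_span.
have XG (i : 'I_(size s)) : grouplike X`_i.
  by apply: sG; rewrite inE mem_nth ?orbT.
have coordX (i j : 'I_(size s)) : coord X i X`_j =
  (i == j)%:R by rewrite coord_free // eq_sym.
have cL i : linear (coord X i : H -> K^o) by move=> k u v; rewrite linearP.
have aa i j : a i * a j = (i == j)%:R * a i.
  pose B (u v : H) : K^o := coord X i u * coord X j v.
  have BB : bilinear_map B.
    split=> z k u v; rewrite /B linearP /=.
      by rewrite mulrDl; congr (_ + _); rewrite [RHS]mulrA.
    by rewrite mulrDr; congr (_ + _); rewrite [LHS]mulrCA.
  have Dx' : tp x x = \sum_k tp (a k *: X`_k) X`_k.
    rewrite -Dx xE comulT_sum; apply: eq_bigr => k _.
    by rewrite comulTZ tpZl; have [-> _] := XG k.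
  have := congr1 (tlift B) Dx'; rewrite (tlift_sum _ _ _ _ BB).
  have -> : tlift B (tp x x) = a i * a j by rewrite tliftE //; have [] := BB.
  move=> ->; rewrite (bigD1 i) //= /B linearZ /= !coordX eqxx big1 ?addr0.
    by rewrite mulr1 mulrC eq_sym.
  by move=> k ki; rewrite linearZ /= coordX eq_sym (negbTE ki) mulr0 mul0r.
have [i ai] : exists i, a i != 0.
  apply/existsP; rewrite -[X in is_true X]negbK negb_exists;
    apply/negP => /forallP a0.
  have x0 : x = 0 by rewrite xE big1 // => i _; have := a0 i;
    rewrite negbK => /eqP ->; rewrite scale0r.
  by move: ex; rewrite x0 (linear_fun0 (X := K^o) (@counit_linear K H)) =>
    /esym/eqP; rewrite oner_eq0.
have ai1 : a i = 1 by apply: (mulfI ai); rewrite aa eqxx mul1r mulr1.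
have aj j : j != i -> a j = 0.
  by move=> ji; apply: (mulfI ai); rewrite aa eq_sym (negbTE ji) mul0r mulr0.
have : x = X`_i.
  by rewrite xE (bigD1 i) //= ai1 scale1r big1 ?addr0 // => j /aj ->;
    rewrite scale0r.
by move=> xi; move: xs; rewrite xi mem_nth.
Qed.

(** Among [(dim H).+1] powers two coincide, by linear independence, and grouplikes are
    invertible. *)
Lemma grouplike_order x : grouplike x -> exists2 N, (0 < N)%N & x ^+ N = 1.
Proof.
move=> xG; have xnG n : grouplike (x ^+ n).
  by elim: n => [|n IHn]; [exact: grouplike1 | rewrite exprS;
    exact: grouplikeM].
have xnV n : antipode (x ^+ n) * x ^+ n =
  1 by have [] := grouplike_antipode (xnG n).
pose s := [seq x ^+ i | i <- iota 0 (dim H).+1].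
have [|] := boolP (uniq s).
  move=> U; have := grouplike_free U _; rewrite /free.
  move=> F; have /F/eqP E : forall y, y \in s -> grouplike y.
    by move=> y /mapP[i _ ->].
  have : (\dim <<s>>%VS <= \dim {:H})%N by exact: dimvS (subvf _).
  by rewrite E size_map size_iota dimvf ltnn.
case/(uniqPn 1) => i [j [ij]]; rewrite size_map size_iota => jn.
rewrite !(nth_map 0%N) ?size_iota ?(ltn_trans ij) // !nth_iota ?(ltn_trans ij)
  // !add0n => E.
exists (j - i)%N; first by rewrite subn_gt0.
have := congr1 (fun z => antipode (x ^+ i) * z) E.
have -> : x ^+ j = x ^+ i * x ^+ (j - i) by rewrite -exprD subnKC // ltnW.
by rewrite xnV mulrA xnV mul1r.
Qed.

End Grouplike.

(** * Integrals on H, the distinguished grouplike element, and S^4 = 1 *)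

Section LarsonRadford.
Variables (K : closedFieldType) (K0 : [pchar K] =i pred0).
Variables (H : hopfAlg K) (H_ss : semisimple H).
Local Notation b := (vbas : 'I_(dim H) -> H).
Local Notation S := (@antipode K H).
Local Notation eps := (@counit K H).
Local Notation sg := (fun x : H => S (S x)).
Local Notation t := (@regtrace K H).
Implicit Types h x y a : H.

Variable (L : H).
Hypotheses (eL : eps L = 1) (hL : forall h, h * L = eps h *: L)
  (cL : central L).
Local Notation p := (integral_comp L).
Local Notation m := (@twisted_trace K H).

Let SI := antipode_inj H_ss eL hL cL.
Let SE := antipode_eq0 H_ss eL hL cL.
Let mL := twisted_trace_left_integral H.

Lemma twisted_trace_nakayama x y : m (x * y) = m (y * sg x).
Proof.
have LS z : linear (fun u => z * sg u) by move=> a u v;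
  rewrite antipode2L mulrDr -scalerAr.
transitivity (ltrace ((fun u => x * u) \o (fun u => y * sg u))).
  by apply: eq_ltrace => u /=; rewrite mulrA.
rewrite ltrace_comp //; last exact: mull_linear.
by apply: eq_ltrace => u /=; rewrite !antipodeM mulrA.
Qed.

Lemma regtrace_antipode x : t (S x) = t x.
Proof.
rewrite -[RHS](ltrace_mulr K0 H_ss); apply: (ltrace_conj (s := S)) => [||||y].
- exact: mull_linear.
- exact: mulr_linear.
- exact: antipodeL.
- exact: SE.
by rewrite antipodeM.
Qed.

Variable (w : H).
Hypothesis mw : forall x, m x = t (w * x).

Lemma mul_antipode2 x : w * x = sg x * w.
Proof.
apply: (regtrace_ext K0 H_ss) => y;
  rewrite -mulrA -mw twisted_trace_nakayama mw.
by rewrite mulrA regtraceC mulrA.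
Qed.

(** If [w * x = 0], all coefficients [m (x * b k) = t (w * x * b k)] in the expansion of [S x]
    vanish, hence [x = 0]. *)
Lemma twist_invertible : exists v, w * v = 1 /\ v * w = 1.
Proof.
have w0 x : w * x = 0 -> x = 0.
  move=> wx; apply: SE; rewrite (antipode_twisted_trace eL hL cL) big1 // => k
    _.
  by rewrite mw mulrA wx mul0r /regtrace (eq_ltrace (g := fun=> 0)) ?scale0r //
    => [|y]; rewrite ?mul0r //;
     rewrite /ltrace big1 ?scale0r // => i _; rewrite /vcoef linear0 mxE.
have [v wv] := inj_surj (@mull_linear K H w) w0 1.
exists v; split=> //; apply/eqP; rewrite -subr_eq0; apply/eqP/w0.
by rewrite mulrBr mulrA wv mul1r mulr1 subrr.
Qed.

Variable (v : H).
Hypotheses (wv : w * v = 1) (vw : v * w = 1).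
Variable (w' : H).
Hypothesis Sw' : S w' = w.

Lemma antipode2_conj x : sg x = w * x * v.
Proof. by rewrite mul_antipode2 -mulrA wv mulr1. Qed.

(** Undoing [S] in the commutation rule of [w] gives [y * w' = w' * sg y], with the twist on the
    other side; in the product the two twists cancel. *)
Lemma central_preimage_mul : central (w' * w).
Proof.
move=> y; have E : y * w' = w' * sg y.
  by apply: SI; rewrite !antipodeM Sw' -mul_antipode2.
by rewrite -mulrA mul_antipode2 mulrA -E mulrA.
Qed.

Lemma twisted_trace_S x : m (S x) = t (x * w').
Proof. by rewrite mw -Sw' -antipodeM regtrace_antipode. Qed.

Lemma twisted_trace_S_scalar : scalar (fun x => m (S x)).
Proof. by move=> a x y; rewrite antipodeL twisted_trace_scalar. Qed.

Lemma twisted_trace_S_L : m (S L) = 1.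
Proof.
rewrite twisted_trace_S cL hL regtraceZ (regtrace_integral eL hL cL) mulr1
  -counitS Sw' -[eps w]mulr1.
by rewrite -[X in _ * X](regtrace_integral eL hL cL) -regtraceZ -hL -mw
  (twisted_trace_integral eL hL cL).
Qed.

(** The antipode reverses coproducts, so it turns the left integral [m] into a right one. *)
Lemma twisted_trace_S_right_integral h :
  rconv (fun x => m (S x)) h = (m (S h))%:A.
Proof.
move: h; apply: comatl_ext => [||i j];
  [exact: rconv_linear | exact: (scalar_alg_linear twisted_trace_S_scalar) |].
apply: SI; rewrite rconv_comatl; last exact: twisted_trace_S_scalar.
rewrite antipode_sum; under eq_bigr do rewrite antipodeZ.
by rewrite (left_integral_sum mL (comulT_antipode_comatl i j)) antipodeZ
  antipode1.
Qed.

Lemma contr_shiftr (phi : H -> K) a : scalar phi ->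
  \sum_k phi (p k * a) *: b k = rconv phi L * S a.
Proof.
move=> pL; have pA := scalar_alg_linear (A := H) pL.
have := congr1 (contr (fun y => (phi y)%:A) id) (integral_shiftr hL cL a).
rewrite !(contr_sum pA (@id_linear _ _)); under eq_bigr do rewrite scal_mull.
move=> ->; rewrite (rconv_sum pL (comulT_integral L)) mulr_suml;
  apply: eq_bigr => k _.
by rewrite scal_mull scalerAl.
Qed.

Lemma antipode_twisted_traceS a : S a = \sum_k m (S (p k * a)) *: b k.
Proof.
by rewrite (contr_shiftr a twisted_trace_S_scalar)
  twisted_trace_S_right_integral twisted_trace_S_L scal_mull scale1r.
Qed.

(** Write [phi x = m (x * S q)]. Then [phi(L) 1 = phi(L2) L1 = m(L2 S(q)) L1 = m(L2) L1 q = q]. *)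
Lemma left_integral_unique phi :
  left_integral phi -> forall x, phi x = phi L * m x.
Proof.
move=> pI; have [pL _] := pI; have pA := scalar_alg_linear (A := H) pL.
have [u uE] := regtrace_riesz K0 H_ss pL.
have [q qE] := antipode_surj H_ss eL hL cL (u * v).
have pE x : phi x = m (x * S q).
  by rewrite mw mulrA regtraceC qE mulrA -(mulrA u v w) vw mulr1 uE.
suff q1 : q = (phi L)%:A by move=> x;
  rewrite pE q1 antipodeZ antipode1 scal_mul twisted_traceZ.
have := left_integral_antipode hL 1 pI; rewrite antipode1 => <-.
have mA := scalar_alg_linear (A := H) (@twisted_trace_scalar K H).
have E : \sum_k m (b k) *: (p k * q) = \sum_k m (b k * S q) *: p k.
  transitivity (contr id (fun y => (m y)%:A) (\sum_k tp (p k * q) (b k))).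
    by rewrite (contr_sum (@id_linear _ _) mA); apply: eq_bigr => k _;
      rewrite scal_mul.
  rewrite (integral_shiftr hL cL) (contr_sum (@id_linear _ _) mA).
  by apply: eq_bigr => k _; rewrite scal_mul.
under eq_bigr do rewrite mul1r pE.
rewrite -E; have := antipode_twisted_trace eL hL cL 1; rewrite antipode1 => E1.
rewrite -[LHS]mul1r E1 mulr_suml; apply: eq_bigr => k _.
by rewrite mul1r -scalerAl.
Qed.

(** The element [m(L1) L2], which measures how far the left integral [m] is from being a right
    integral. *)
Definition dist_grouplike := rconv m L.

(** By coassociativity every coordinate of [rconv m] is again a left integral, hence a multiple of
    [m]. *)
Lemma rconv_twisted_trace h : rconv m h = m h *: dist_grouplike.
Proof.
apply: vcoef_ext => i; rewrite (scalar_funZ _ _ (vcoef_linear i)).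
have RL := rconv_linear m.
have fI : left_integral (fun x => vcoef i (rconv m x)).
  split=> [a x y|k]; first by rewrite RL vcoef_linear.
  transitivity (\sum_j \sum_l (m (comatl j l) * vcoef i (b l)) *: comatl k j).
    apply: eq_bigr => j _; rewrite rconv_vbas; last exact: twisted_trace_scalar.
    rewrite (scalar_fun_sum _ _ _ (vcoef_linear i)) scaler_suml;
      apply: eq_bigr => l _.
    by rewrite (scalar_funZ _ _ (vcoef_linear i)).
  rewrite exchange_big rconv_vbas; last exact: twisted_trace_scalar.
  rewrite (scalar_fun_sum _ _ _ (vcoef_linear i)) scaler_suml;
    apply: eq_bigr => l _ /=.
  rewrite (scalar_funZ _ _ (vcoef_linear i)) mulrC -scalerA -(left_integral_sum
    mL (comulT_comatl k l)).
  by rewrite scaler_sumr; apply: eq_bigr => j _; rewrite scalerA mulrC.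
by rewrite (left_integral_unique fI) mulrC.
Qed.

Lemma dist_grouplike_grouplike : grouplike dist_grouplike.
Proof.
split.
  suff E h : comulT (rconv m h) = tp dist_grouplike (rconv m h) by exact: E.
  have RL := rconv_linear m.
  move: h; apply: vbas_ext => [a x y|a x y|i].
  - by rewrite RL comulT_linear.
  - by rewrite RL tp_linearr.
  rewrite rconv_vbas; last exact: twisted_trace_scalar.
  rewrite comulT_sum tp_sumr.
  under eq_bigr do rewrite comulTZ comulT_vbasl scaler_sumr.
  rewrite exchange_big; apply: eq_bigr => k _ /=.
  rewrite -tpZ -rconv_twisted_trace rconv_comatl;
    last exact: twisted_trace_scalar.
  by rewrite tp_suml; apply: eq_bigr => j _; rewrite tpZl.
rewrite /dist_grouplike (rconv_sum (@twisted_trace_scalar K H) (comulT_integral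
  L)) counit_sum -(twisted_trace_integral eL hL cL).
rewrite -[L in RHS](counitr_sum (comulT_integral L)) twisted_trace_sum;
  apply: eq_bigr => k _.
by rewrite counitZ twisted_traceZ mulrC.
Qed.

(** With [q = w' * v] one has [m (S x) = m (x * q)]. Expanding [S 1] by the right integral gives
    [1 = m(L1 q) L2 = g S(q)], with g the distinguished grouplike, so [S q = S g] and [q = g]. *)
Lemma dist_grouplikeE : w' = dist_grouplike * w.
Proof.
have [gS Sg] := grouplike_antipode dist_grouplike_grouplike.
pose q := w' * v; have qw : q * w = w' by rewrite -mulrA vw mulr1.
have lamE x : m (S x) = m (x * q).
  by rewrite twisted_trace_S mw regtraceC -qw mulrA [RHS]regtraceC !mulrA
    regtraceC !mulrA.
have := antipode_twisted_traceS 1; rewrite antipode1.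
under eq_bigr do rewrite mulr1 lamE.
rewrite (contr_shiftr q (@twisted_trace_scalar K H)) -/dist_grouplike => gSq.
have : S q = S dist_grouplike by rewrite -[LHS]mul1r -Sg -mulrA -gSq mulr1.
by move/SI => qg; rewrite -qw qg.
Qed.

Lemma ltrace_antipode2_neq0 : ltrace sg != 0.
Proof.
have [N N0 gN] := grouplike_order dist_grouplike_grouplike.
have zE : dist_grouplike * w ^+ 2 =
  w' * w by rewrite dist_grouplikeE expr2 mulrA.
have gw : GRing.comm dist_grouplike w.
  have [c cc ->] : exists2 c, central c & dist_grouplike = c * (v * v).
    exists (w' * w); first exact: central_preimage_mul.
    by rewrite dist_grouplikeE -!mulrA (mulrA w v) wv mul1r wv mulr1.
  by rewrite /GRing.comm [RHS]mulrA -(cc w) -!mulrA vw (mulrA w v) wv mul1r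
    mulr1.
(* Since g commutes with [w] and [g ^+ N = 1], the N-th power of the central element
   [w' * w = g * w ^+ 2] is [w ^+ (2 * N)]. *)
have cM : central (w ^+ (2 * N)).
  have -> : w ^+ (2 * N) = (w' * w) ^+ N.
    rewrite -zE exprMn_comm ?gN ?mul1r ?exprM //.
    exact: commrX.
  by elim: (N) => [|k IHk]; [move=> y; rewrite mul1r mulr1 | rewrite exprS;
    apply: centralM (central_preimage_mul) IHk].
have L0 : L != 0.
  by apply: contraTneq (oner_neq0 K) => L0;
    rewrite -eL L0 (linear_fun0 (X := K^o) (@counit_linear K H)) eqxx.
rewrite (eq_ltrace antipode2_conj);
  apply: (@ltrace_inner_neq0 _ K0 _ H_ss w v L (2 * N)) => //.
- by rewrite muln_gt0.
- by split=> //; exact: integral_idem.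
by move=> x; exists (eps x).
Qed.

Lemma twisted_trace1 : m 1 = ltrace sg.
Proof. by apply: eq_ltrace => x; rewrite mul1r. Qed.

Lemma antipode2_involutive x : sg (sg x) = x.
Proof.
(* Evaluate [m(h1) h2 = m(h) g] at [h = 1], where [m 1 = tr (S^2)] is nonzero. *)
have g1 : dist_grouplike = 1.
  have := rconv_twisted_trace 1; rewrite (@rconv_sum _ _ _ 1 'I_1 (fun=> 1)
    (fun=> 1)).
  - rewrite big_ord1 => /(scalerI (_ : m 1 != 0)) -> //.
    by rewrite twisted_trace1 ltrace_antipode2_neq0.
  - exact: twisted_trace_scalar.
  - by rewrite big_ord1 comulT1.
have cw : central (w * w) by have := central_preimage_mul;
  rewrite dist_grouplikeE g1 mul1r.
rewrite [LHS]antipode2_conj [S (S x)]antipode2_conj -!mulrA (mulrA w w) !mulrA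
  cw.
by rewrite -!mulrA (mulrA w v) wv mul1r wv mulr1.
Qed.

End LarsonRadford.

(** * The regular character under convolution *)

Section RegularCharacter.
Variables (K : fieldType) (H : hopfAlg K).
Local Notation b := (vbas : 'I_(dim H) -> H).
Local Notation S := (@antipode K H).
Local Notation t := (@regtrace K H).

(* [H ⊗ H] with the diagonal action is free over [H]: the matrix [comatr]
   conjugates [h1 ⊗ h2] into [h ⊗ 1]. *)
Lemma regtrace_rconv h : t (rconv t h) = (\dim {:H})%:R * t h.
Proof.
have tL := @regtrace_linear K H; have RL := rconv_linear t.
move: h; apply: vbas_ext_scalar => [a x y|a x y|p]; first by rewrite RL tL.
  by rewrite tL mulrDr mulrCA.
pose l k i := vcoef k (b p * b i).
pose q j i : H := \sum_r vcoef j (comatl p r * b i) *: b r.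
have I1 j i : \sum_k q j k * comatr k i = \sum_k l k i *: comatr j k.
  move: j; apply: (@tensor_coef_injl _ H H).
  transitivity (comulT (b p * b i)); last first.
    rewrite [X in comulT X]vbas_sum comulT_sum.
    under eq_bigr do rewrite comulTZ comulT_vbasr scaler_sumr.
    rewrite exchange_big; apply: eq_bigr => j _; rewrite tpure_sumr.
    by apply: eq_bigr => k _; rewrite tpureZr.
  rewrite comulTM comulT_vbasl [comulT (b i)]comulT_vbasr mulr_suml.
  transitivity (\sum_r \sum_k \sum_j b j ⊗ (vcoef j (comatl p r * b k) *: (b r
    * comatr k i))).
    rewrite exchange_big.
    under [RHS]eq_bigr do rewrite exchange_big.
    rewrite exchange_big; apply: eq_bigr => j _ /=;
      rewrite -[LHS]/(tp _ _) tp_sumr.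
    apply: eq_bigr => k _ /=; rewrite mulr_suml tp_sumr.
    by apply: eq_bigr => r _; rewrite -scalerAl.
  apply: eq_bigr => r _; rewrite mulr_sumr; apply: eq_bigr => k _.
  rewrite tpM [X in tp X _]vbas_sum tp_suml; apply: eq_bigr => j _.
  by rewrite tpZ.
have I3 j : q j j = \sum_i \sum_k l k i *: (comatr j k * S (comatr i j)).
  transitivity (\sum_k q j k * (k == j)%:R); first by rewrite sum_deltar.
  under eq_bigr do rewrite -comatr_antipode mulr_sumr.
  rewrite exchange_big; apply: eq_bigr => i _ /=.
  under eq_bigr do rewrite mulrA.
  rewrite -mulr_suml I1 mulr_suml; apply: eq_bigr => k _.
  by rewrite -scalerAl.
transitivity (\sum_j t (q j j)).
  rewrite rconv_vbas // regtrace_sum.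
  under [RHS]eq_bigr do rewrite regtrace_sum.
  rewrite [RHS]exchange_big; apply: eq_bigr => r _ /=.
  by rewrite regtraceZ mulr_suml; apply: eq_bigr => j _; rewrite regtraceZ.
under eq_bigr do rewrite I3 regtrace_sum.
rewrite exchange_big [t (b p)]/regtrace /ltrace mulr_sumr;
  apply: eq_bigr => i _ /=.
under eq_bigr do rewrite regtrace_sum.
rewrite exchange_big /=.
have I4 k : \sum_j t (l k i *: (comatr j k * S (comatr i j))) =
  (i == k)%:R * (l k i * (\dim {:H})%:R).
  under eq_bigr do rewrite regtraceZ regtraceC.
  rewrite -mulr_sumr -regtrace_sum antipode_comatr.
  case: eqP => _; last by rewrite mul0r [t _](linear_fun0 (X := K^o) tL) mulr0.
  by rewrite mul1r /regtrace (eq_ltrace (g := id)) ?ltrace_id // => x;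
    rewrite mul1r.
under eq_bigr do rewrite I4.
by rewrite (sum_deltal (fun k => l k i * _)) mulrC.
Qed.

(** Coassociativity reduces this to [regtrace_rconv]: the convolution square of [t] is n times [t],
    so that [rconv t / n] is idempotent. *)
Lemma rconv_regtrace h : rconv t (rconv t h) = (\dim {:H})%:R *: rconv t h.
Proof.
have tL := @regtrace_linear K H; have RL := rconv_linear t.
move: h; apply: vbas_ext => [a x y|a x y|i]; first by rewrite !RL.
  by rewrite RL scalerDr !scalerA mulrC.
rewrite rconv_vbas // (linear_fun_sum _ _ _ RL) scaler_sumr.
under eq_bigr do rewrite (linear_funZ _ _ RL) rconv_vbas // scaler_sumr.
rewrite exchange_big; apply: eq_bigr => k _ /=.
rewrite scalerA -regtrace_rconv rconv_comatl // regtrace_sum scaler_suml.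
by apply: eq_bigr => j _; rewrite regtraceZ scalerA.
Qed.

End RegularCharacter.

(** * S^2 = 1 and the trace formula for convolution operators *)

Section TraceFormula.
Variables (K : closedFieldType) (K0 : [pchar K] =i pred0).
Variables (H : hopfAlg K) (H_ss : semisimple H).
Local Notation b := (vbas : 'I_(dim H) -> H).
Local Notation S := (@antipode K H).
Local Notation sg := (fun x : H => S (S x)).
Local Notation t := (@regtrace K H).
Variable (L : H).
Hypotheses (eL : counit L = 1) (hL : forall h, h * L = counit h *: L)
  (cL : central L).

Lemma antipode_pow4 : ltrace sg != 0 /\ forall x, sg (sg x) = x.
Proof.
have [w mw] := regtrace_riesz K0 H_ss (@twisted_trace_scalar K H).
have [v [wv vw]] := twist_invertible H_ss eL hL cL mw.
have [w' Sw'] := antipode_surj H_ss eL hL cL w.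
split; first exact: (ltrace_antipode2_neq0 K0 H_ss eL hL cL mw wv vw Sw').
exact: (antipode2_involutive K0 H_ss eL hL cL mw wv vw Sw').
Qed.

Lemma rconv_regtrace_antipode2 h : rconv t (sg h) = sg (rconv t h).
Proof.
have tL := @regtrace_linear K H; have RL := rconv_linear t.
move: h; apply: vbas_ext => [a x y|a x y|i];
  rewrite ?antipode2L ?RL ?antipode2L //.
rewrite (rconv_sum tL (comulT_antipode2 i)) rconv_vbas // !antipode_sum;
  apply: eq_bigr => j _.
by rewrite !(regtrace_antipode K0 H_ss eL hL cL) !antipodeZ.
Qed.

Lemma dimH_neq0 : (\dim {:H})%:R != 0 :> K.
Proof.
have /pcharf0P -> := K0; rewrite -lt0n lt0n dimv_eq0;
  apply: contraNneq (oner_neq0 H) => H0.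
by rewrite -memv0 -H0 memvf.
Qed.

(* The projection [rconv t / n] commutes with the involution [S ^ 2], so
   [tr (S ^ 2)] is a nonzero multiple of [n], which forces [S ^ 2 = 1]. *)
Lemma antipode_involutive x : sg x = x.
Proof.
have [D0 sgsg] := antipode_pow4; have n0 := dimH_neq0; set n := \dim {:H} in n0.
have tL := @regtrace_linear K H; have RL := rconv_linear t.
have two : 2%:R != 0 :> K by have /pcharf0P -> := K0.
pose P (x : H) := 2%:R^-1 *: (x + sg x).
have PL : linear P.
  move=> a u v; rewrite /P antipode2L addrACA scalerDr; congr (_ + _).
  by rewrite -scalerDr !scalerA mulrC.
have sgP u : sg (P u) = P u by rewrite /P !antipodeZ !(linear_funD _ _
  (@antipodeL K H)) sgsg addrC.
have PP u : P (P u) = P u.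
  by rewrite {1}/P sgP -mulr2n -scaler_nat scalerA mulVf // scale1r.
pose E (x : H) := n%:R^-1 *: rconv t x.
have EL : linear E by move=> a u v; rewrite /E RL scalerDr !scalerA mulrC.
have EE u : E (E u) = E u.
  by rewrite /E (linear_funZ _ _ RL) rconv_regtrace -/n !scalerA -mulrA mulVf
    // mulr1.
have sgEL u : sg (E u) = E (sg u)
  by rewrite /E !antipodeZ rconv_regtrace_antipode2.
have EP u : E (P u) = P (E u).
  by rewrite /P (linear_funZ _ _ EL) (linear_funD _ _ EL) sgEL.
have EPL : linear (fun u => E (P u)) by move=> a u v; rewrite PL EL.
have [U tU UE] := ltrace_idem PL PP.
have [U1 tU1 _] := ltrace_idem EL EE.
have [|U2 tU2 _] := ltrace_idem EPL; first by move=> u; rewrite -EP PP EE.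
have sgPE u : sg u = 2%:R *: P u + (-1) *: u.
  by rewrite /P scalerA mulfV // scale1r scaleN1r addrAC subrr add0r.
have D1 : ltrace sg = 2%:R * (\dim U)%:R - n%:R.
  by rewrite (eq_ltrace sgPE) ltraceD (ltraceZ 2%:R P) (ltraceZ (-1) id) tU
    ltrace_id mulN1r.
(* Radford's formula for [f = t], where [t L = 1]; here [rconv t] is n times the projection [E], and
   [sg = 2 P - 1]. *)
have D2 : ltrace sg = n%:R * (2%:R * (\dim U2)%:R - (\dim U1)%:R).
  have := ltrace_rconv_antipode2 eL hL cL tL;
    rewrite (regtrace_integral eL hL cL) mul1r twisted_trace1 => <-.
  rewrite -tU2 -tU1 -mulN1r -!ltraceZ -ltraceD -ltraceZ; apply: eq_ltrace => u.
  rewrite sgPE /E; move: (P u) => y;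
    rewrite (linear_funD _ _ RL) !(linear_funZ _ _ RL).
  by rewrite scalerDr !scalerA (mulrAC _ 2) (mulrAC _ (-1)) mulfV // !mul1r.
have D3 : 2 * (\dim U)%:Z - n%:Z = n%:Z * (2 * (\dim U2)%:Z - (\dim U1)%:Z).
  by apply: (intf_inj K0); rewrite !(rmorphB, rmorphM) /= -D1 -D2.
have D4 : 2 * (\dim U)%:Z - n%:Z != 0.
  rewrite -(intf_eq0 K0) rmorphB rmorphM /=.
  by rewrite -D1.
have Un : (\dim U <= n)%N by exact: dimvS (subvf _).
(* The element 1 is fixed by S^2, which excludes the trace -n. A nonzero multiple of n in the
   interval from -n + 1 to n is n, so [U] is everything. *)
have U0 : (0 < \dim U)%N.
  rewrite lt0n dimv_eq0; apply/negP => /eqP U0.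
  have : (1 : H) \in U by rewrite UE /P !antipode1 -mulr2n -scaler_nat scalerA
    mulVf // scale1r.
  by rewrite U0 memv0 oner_eq0.
have nU : (n <= \dim U)%N.
  move: D3 D4; move: (2 * _ - (\dim U1)%:Z) => k; move: (\dim U) Un U0 => d;
    move: (n) => N.
  move=> dn d0 E1 E2; rewrite leqNgt; apply/negP => lt_d.
  have [k0|[k1|k1]] : k = 0 \/ (k <= -1 \/ 1 <= k) by lia.
  - by move: E2; rewrite E1 k0 mulr0.
  - nia.
  - nia.
have xU : x \in U.
  by have /eqP -> : U == fullv; rewrite ?memvf // eqEdim subvf.
by rewrite sgPE; move: xU; rewrite UE => /eqP ->;
  rewrite scaler_nat mulr2n scaleN1r addrK.
Qed.

Lemma ltrace_rconv f : scalar f -> ltrace (rconv f) = (\dim {:H})%:R * f L.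
Proof.
move=> fL; rewrite (eq_ltrace (g := fun x => rconv f (sg x))); last first.
  by move=> x; rewrite antipode_involutive.
rewrite (ltrace_rconv_antipode2 eL hL cL fL) twisted_trace1 mulrC;
  congr (_ * _).
by rewrite (eq_ltrace (g := id)) ?ltrace_id // => x; exact: antipode_involutive.
Qed.

End TraceFormula.

(** * Characters of tensor powers *)

Lemma ltrace_tmap (K : fieldType) (U W : vectType K) (f : U -> U) (g : W -> W) :
  ltrace (tmap f g : tens U W -> tens U W) = ltrace f * ltrace g.
Proof.
rewrite (@ltrace_dual _ (tens U W) _ (fun ij (s : tens U W) => (s : 'M_(dim U,
  dim W)) ij.1 ij.2)
  (fun ij => f (vbas ij.1) ⊗ g (vbas ij.2))).
- rewrite /ltrace big_distrlr /=.
  rewrite -(pair_bigA _ (fun i j => (f (vbas i) ⊗ g (vbas j) : 'M_(dim U, dim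
    W)) i j)).
  apply: eq_bigr => i _ /=; apply: eq_bigr => j _.
  by rewrite /tpure mxE big_ord1 mxE.
- by move=> ij a x y; rewrite !mxE.
by move=> s; rewrite /tmap /tlift pair_bigA.
Qed.

Section Characters.
Variables (K : closedFieldType) (K0 : [pchar K] =i pred0) (H : hopfAlg K).
Implicit Types U V W : lmodule H.
Local Notation b := (vbas : 'I_(dim H) -> H).

Definition character V (h : H) : K := ltrace (act (l := V) h).

Lemma character_scalar V : scalar (@character V).
Proof. by move=> a x y; rewrite /character -ltraceZ -ltraceD;
  apply: eq_ltrace => v; rewrite act_linearl. Qed.

Lemma character_tensor U W h (I : finType) (u w : I -> H) :
  comulT h = \sum_i tp (u i) (w i) ->
  character (tensor_module U W) h =
    \sum_i character U (u i) * character W (w i).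
Proof.
move=> E; under eq_bigr do rewrite -ltrace_tmap.
rewrite -ltrace_sum; apply: eq_ltrace => s.
have := tlift_sum (index_enum I) xpredT u w (conj (tmap_act_linearl s)
  (tmap_act_linearr s)).
by rewrite -E.
Qed.

Lemma character_trivial h : character (trivial_module H) h = counit h.
Proof.
rewrite /character (@ltrace_dual _ _ 'I_1 (fun _ (x : K^o) => x) (fun _ =>
  counit h : K^o)).
- by rewrite big_ord1.
- by [].
by move=> x; rewrite big_ord1 /= [LHS]mulrC.
Qed.

(** Characters of tensor products are convolution products, and [rconv] turns convolution into
    composition; the trivial module gives the counit, hence the identity. *)
Lemma rconv_tensor_power V k h :
  rconv (character (tensor_power V k)) h = iter k (rconv (character V)) h.
Proof.
elim: k h => [|k IHk] h.
  move: h; apply: vbas_ext => [|//|i]; first exact: rconv_linear.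
  rewrite rconv_vbas; last exact: character_scalar.
  under eq_bigr do rewrite character_trivial.
  exact: counitl_sum (comulT_vbasl i).
rewrite iterS -IHk; have RL := rconv_linear (character V).
have RLk := rconv_linear (character (tensor_power V k)).
move: h; apply: vbas_ext => [|a x y|i]; first exact: rconv_linear.
  by rewrite RLk RL.
rewrite !rconv_vbas; try exact: character_scalar.
rewrite (linear_fun_sum _ _ _ RL).
under [RHS]eq_bigr do rewrite (linear_funZ _ _ RL) (rconv_vbas _
  (@character_scalar V)) scaler_sumr.
rewrite [RHS]exchange_big; apply: eq_bigr => j _ /=.
rewrite (character_tensor _ _ (comulT_comatl i j)) scaler_suml.
by apply: eq_bigr => l _; rewrite scalerA.
Qed.

(** [L] acts on [V] as a projection onto the invariants. *)
Lemma character_integral V (L : H) :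
  counit L = 1 -> (forall h, h * L = counit h *: L) ->
  character V L = (\dim (invariants V))%:R.
Proof.
move=> eL hL; apply: ltrace_proj => [|x|x /invariantsP xI];
  first exact: act_linearr.
  apply/invariantsP => h; rewrite -actM hL.
  exact: (linear_funZ _ _ (act_linearl (l := V) x)).
by rewrite xI eL scale1r.
Qed.

Lemma character1 V : character V 1 = (\dim {:V})%:R.
Proof. by rewrite /character (eq_ltrace (g := id)) ?ltrace_id // => x;
  rewrite act1. Qed.

Lemma rconv1 (f : H -> K) : scalar f -> rconv f 1 = f 1 *: 1.
Proof.
move=> fL; have E : comulT 1 = \sum_(i < 1) tp (1 : H) 1
  by rewrite big_ord1 comulT1.
by rewrite (rconv_sum fL E) big_ord1.
Qed.

End Characters.

Theorem theorem4p2 (K : closedFieldType) (K_char0 : [pchar K] =i pred0)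
    (H : hopfAlg K) (H_semisimple : semisimple H)
    (V : lmodule H) (V_neq0 : fullv != 0%VS :> {vspace V}) :
  exists m : nat,
    [/\ ord V = Some m,
        (m <= \dim {:H})%N
      & (m %| \dim {:H} * mult V)%N].
Proof.
have [L [eL hL cL]] := integral_exists H_semisimple.
pose d k := \dim (invariants (tensor_power V k)).
have RL := rconv_linear (character V).
have [s [ss st _ sE]] := ltrace_spectrum RL.
have sN k : (0 < k)%N -> \sum_(x <- s) x ^+ k = (\dim {:H} * d k)%:R.
  move=> _; rewrite -st -(eq_ltrace (rconv_tensor_power V k)).
  rewrite (ltrace_rconv K_char0 H_semisimple eL hL cL (character_scalar _)).
  by rewrite (character_integral _ eL hL) natrM.
have s_neq0 : has (fun x => x != 0) s.
  apply/hasP; exists (character V 1).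
    by apply: (sE _ 1); [exact: oner_neq0 | exact: rconv1 (@character_scalar _
      _ V)].
  by rewrite character1 (natf_eq0 K_char0) dimv_eq0.
(* As [s] has [\dim {:H}] entries, some tensor power of exponent at most the dimension of H has
   invariants; this gives both finiteness and the bound. *)
have [k /andP[k0 k_le] Nk] := power_sums_nonzero K_char0 sN s_neq0.
have dE j : (d j == 0%N) = (invariants (tensor_power V j) == 0%VS)
  by exact: dimv_eq0.
have Vk : has_invariants V k.
  by rewrite /has_invariants k0 -dE; apply: contra_neq Nk => ->; rewrite muln0.
have [m ordE [Vm m_min]] : exists2 m, ord V = Some m &
    has_invariants V m /\ forall j, has_invariants V j -> (m <= j)%N.
  rewrite /ord; case: pselect => [exV|[]]; last by exists k.
  by case: ex_minnP => m Vm m_min; exists m.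
have m0 : (0 < m)%N by case/andP: Vm.
exists m; split=> //; first by rewrite (leq_trans (m_min k Vk)) // -ss.
rewrite /mult ordE; apply: (power_sums_divisibility K_char0 sN m0) => j
  /andP[j0 jm].
apply/eqP; rewrite muln_eq0 dE; apply/orP; right; apply: contraLR jm => dj.
by rewrite -leqNgt m_min // /has_invariants j0.
Qed.
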